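(* Consider the stochastic LQR problem (SLQR) and the deterministic problem (LQRcp) defined in the context, where the model matrices $M_1,\dots,M_{n_w}$ satisfy the model-equivalence assumption $$\operatorname{rank}(M_{(3)})=\operatorname{rank}\begin{bmatrix}M_{(3)}\\ V_{(3)}\end{bmatrix}=n_w .$$ Then the optimal values coincide: $\mathrm{Val}(\mathrm{SLQR})=\mathrm{Val}(\mathrm{LQRcp})$. Moreover, a sequence $(Z_t)_{t\in\mathbb N}$ is feasible for (LQRcp) if and only if there is a feasible input sequence for (SLQR) of the form $u_t=K_tx_t+\delta_t$, with $K_t\in\mathbb R^{n_u\times n_x}$ and $\delta_t\in\mathbb R^{n_u}$ a random vector for every $t\in\mathbb N$, such that $Z_t=\mathbb E[z_tz_t^\top]$ for all $t\in\mathbb N$, where $z_t=(x_t,u_t)$.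
   Context: Dynamics: $x_{t+1}=A(v_t)x_t+B(v_t)u_t$ for $t\in\mathbb N$, $x_t\in\mathbb R^{n_x}$, $u_t\in\mathbb R^{n_u}$, $n_z=n_x+n_u$, where $(v_t)$ is an i.i.d. sequence in $\mathbb R^{n_v}$ with finite second moment, and $A(v)=\sum_{i=1}^{n_v}[v]_iA_i$, $B(v)=\sum_{i=1}^{n_v}[v]_iB_i$ for given matrices $A_i,B_i$. Problem (SLQR): minimize over input sequences $u_0,u_1,\dots$ the cost $\mathbb E\big[\sum_{t=0}^\infty x_t^\top Qx_t+u_t^\top Ru_t\big]$ subject to the dynamics, for a given initial state $x_0$ and given $Q\succ0$, $R\succ0$. A feasible input sequence is one where each $u_t$ is a (possibly randomized) square-integrable random vector such that $(x_t,u_t)$ is independent of $(v_s)_{s\ge t}$; $x_0$ is square integrable (possibly deterministic) and independent of $(v_s)_{s\geq 0}$. Model: $M_1,\dots,M_{n_w}\in\mathbb R^{n_x\times n_z}$ are given matrices; $M_{(3)}\in\mathbb R^{n_w\times n_xn_z}$ has rows $\operatorname{vec}(M_k)^\top$, and $V_{(3)}\in\mathbb R^{n_v\times n_xn_z}$ has rows $\operatorname{vec}([A_i,B_i])^\top$. Put $w_t=(M_{(3)}^\top)^\dagger V_{(3)}^\top v_t\in\mathbb R^{n_w}$ ($\dagger$ is the pseudo-inverse), $W=\mathbb E[w_tw_t^\top]$, and for $Z\in\mathbb R^{n_z\times n_z}$ symmetric $$\mathcal E(Z)=\sum_{k,l=1}^{n_w}[W]_{kl}\,M_kZM_l^\top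 .$$ Problem (LQRcp): with $H=\operatorname{blkdiag}(Q,R)$, minimize $\sum_{t=0}^\infty\operatorname{tr}[Z_tH]$ over sequences of symmetric matrices $Z_t=\begin{bmatrix}X_t & V_t \\ V_t^\top & U_t\end{bmatrix}\succeq0$ (with $X_t\in\mathbb R^{n_x\times n_x}$) subject to $X_{t+1}=\mathcal E(Z_t)$ for all $t\in\mathbb N$, with $X_0=\mathbb E[x_0x_0^\top]$ given. Values may be $+\infty$. *)

(* Defs.v *)
From HB Require Import structures.
From mathcomp Require Import all_boot all_order all_algebra.
From mathcomp Require Import all_classical all_reals all_analysis.

Set Implicit Arguments.
Unset Strict Implicit.
Unset Printing Implicit Defensive.

Import Order.TTheory GRing.Theory Num.Theory.
Import numFieldNormedType.Exports.

Local Open Scope classical_set_scope.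
Local Open Scope ring_scope.

Definition psdmx (R : realType) n (S : 'M[R]_n) : Prop :=
  S^T = S /\ forall x : 'cV[R]_n, 0 <= (x^T *m S *m x) 0 0.

Definition pdmx (R : realType) n (S : 'M[R]_n) : Prop :=
  S^T = S /\ forall x : 'cV[R]_n, x != 0 -> 0 < (x^T *m S *m x) 0 0.

(* The four Penrose equations; [pinvmx] of MathComp only satisfies the first
   one in general. *)
Definition penrose (R : realType) m n (A : 'M[R]_(m, n)) (B : 'M[R]_(n, m)) :
    Prop :=
  [/\ A *m B *m A = A, B *m A *m B = B,
      (A *m B)^T = A *m B & (B *m A)^T = B *m A].

Definition mp_pinv (R : realType) m n (A : 'M[R]_(m, n)) : 'M[R]_(n, m) :=
  xget 0 [set B | penrose A B].

Lemma row_free_gram_unit (R : realType) m n (F : 'M[R]_(m, n)) :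
  row_free F -> F *m F^T \in unitmx.
Proof.
move=> fF; rewrite -row_free_unit -kermx_eq0.
apply/eqP/row_matrixP => i; rewrite row0.
set v := row i _.
have vF0 : v *m (F *m F^T) = 0.
  by apply/sub_kermxP; rewrite /v row_sub.
have {}vF0 : (v *m F) *m (v *m F)^T = 0.
  by rewrite trmx_mul !mulmxA -(mulmxA v) vF0 mul0mx.
have {vF0} : v *m F = 0.
  apply/rowP => j; rewrite [RHS]mxE.
  have := congr1 (fun S : 'M[R]_1 => S 0 0) vF0.
  rewrite mxE [RHS]mxE => S0.
  have vj k : (v *m F) 0 k * (v *m F)^T k 0 = (v *m F) 0 k ^+ 2.
    by rewrite [X in _ * X]mxE expr2.
  have ge0 k : true -> 0 <= (v *m F) 0 k * (v *m F)^T k 0.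
    by rewrite vj sqr_ge0.
  have := psumr_eq0P ge0 S0 (i := j) isT; rewrite vj => /eqP.
  by rewrite sqrf_eq0 => /eqP.
by move=> vF0; apply: (row_free_inj fF); rewrite vF0 mul0mx.
Qed.

Lemma mp_pinvP (R : realType) m n (A : 'M[R]_(m, n)) : penrose A (mp_pinv A).
Proof.
rewrite /mp_pinv; set S := [set B | _].
suff [B SB] : exists B, S B by apply: (@xgetPex _ 0 S); exists B.
have [r [C [F [AE uF uC]]]] : exists r (C : 'M[R]_(m, r)) (F : 'M[R]_(r, n)),
    [/\ A = C *m F, F *m F^T \in unitmx & C^T *m C \in unitmx].
  exists (\rank A), (col_base A), (row_base A); split.
  - by rewrite mulmx_base.
  - exact/row_free_gram_unit/row_base_free.
  - rewrite -[X in _ *m X]trmxK; apply: row_free_gram_unit.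
    by rewrite /row_free mxrank_tr; exact: col_base_full.
set G := invmx (F *m F^T); set H := invmx (C^T *m C).
have GT : G^T = G by rewrite /G trmx_inv trmx_mul trmxK.
have HT : H^T = H by rewrite /H trmx_inv trmx_mul trmxK.
have AB : A *m (F^T *m G *m H *m C^T) = C *m H *m C^T.
  by rewrite AE !mulmxA -(mulmxA C F) -(mulmxA C _ G) mulmxV// mulmx1.
have BA : (F^T *m G *m H *m C^T) *m A = F^T *m G *m F.
  by rewrite AE !mulmxA -(mulmxA _ C^T C) -(mulmxA _ H) mulVmx// mulmx1.
exists (F^T *m G *m H *m C^T); rewrite /S /penrose /= AB BA; split.
- by rewrite AE !mulmxA -(mulmxA _ C^T C) -(mulmxA _ H) mulVmx// mulmx1.
- by rewrite !mulmxA -(mulmxA _ F F^T) -(mulmxA _ (F *m F^T)) mulmxV// mulmx1.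
- by rewrite !trmx_mul trmxK HT mulmxA.
- by rewrite !trmx_mul trmxK GT mulmxA.
Qed.

Lemma penrose_uniq (R : realType) m n (A : 'M[R]_(m, n)) (B C : 'M[R]_(n, m)) :
  penrose A B -> penrose A C -> B = C.
Proof.
move=> [B1 B2 B3 B4] [C1 C2 C3 C4].
have AB : A *m B = A *m C.
  by rewrite -B3 -{1}C1 -(mulmxA (A *m C)) trmx_mul C3 B3 mulmxA B1.
have BA : B *m A = C *m A.
  rewrite -B4 -{1}C1 -mulmxA (mulmxA B) trmx_mul C4 B4.
  by rewrite -(mulmxA C) (mulmxA A) B1.
by rewrite -B2 BA -mulmxA AB mulmxA C2.
Qed.

Section random_vectors.
Context (R : realType) (d : measure_display) (T : measurableType d).
Variable P : probability T R.

Definition random_vector n (X : T -> 'cV[R]_n) : Prop :=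
  forall i, measurable_fun setT (fun w => X w i 0).

Definition square_integrable n (X : T -> 'cV[R]_n) : Prop :=
  forall i, (fun w => X w i 0) \in Lfun P 2%:E.

Definition second_moment n (X : T -> 'cV[R]_n) : 'M[R]_n :=
  \matrix_(i, j) fine 'E_P[fun w => X w i 0 * X w j 0].

(* The sigma-algebra generated by a random vector. *)
Definition sigma_vec n (X : T -> 'cV[R]_n) : set (set T) :=
  g_sigma_preimage (fun i w => X w i 0).

(* The sigma-algebra generated by (v_s)_{s >= t}. *)
Definition sigma_from n (v : nat -> T -> 'cV[R]_n) (t : nat) : set (set T) :=
  <<s \bigcup_(s in [set s | (t <= s)%N]) sigma_vec (v s) >>.

Definition independent (F G : set (set T)) : Prop :=
  forall E1 E2, F E1 -> G E2 -> P (E1 `&` E2) = (P E1 * P E2)%E.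

Definition mutually_independent n (v : nat -> T -> 'cV[R]_n) : Prop :=
  forall (s : seq nat) (E : nat -> set T), uniq s ->
    (forall t, t \in s -> sigma_vec (v t) (E t)) ->
    P (\bigcap_(t in [set` s]) E t) = (\prod_(t <- s) P (E t))%E.

Definition borel_vec n : set (set 'cV[R]_n) :=
  g_sigma_preimage (fun (i : 'I_n) (x : 'cV[R]_n) => x i 0).

Definition identically_distributed n (v : nat -> T -> 'cV[R]_n) : Prop :=
  forall s t C, borel_vec C -> P (v s @^-1` C) = P (v t @^-1` C).

Definition iid n (v : nat -> T -> 'cV[R]_n) : Prop :=
  [/\ forall t, random_vector (v t), mutually_independent v
    & identically_distributed v].

End random_vectors.

(* Randomized inputs live on an extension of the given probability space:
   a probability space with a measure-preserving map onto the given one, along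
   which the given random variables are pulled back. *)
Record extension (R : realType) (d : measure_display) (T : measurableType d)
    (P : probability T R) := Extension {
  ext_display : measure_display ;
  ext_sort :> measurableType ext_display ;
  ext_prob : probability ext_sort R ;
  ext_proj : {mfun ext_sort >-> T} ;
  ext_law : forall E : set T, measurable E ->
    distribution ext_prob ext_proj E = P E
}.

Section SLQR.
Context (R : realType) (nx nu nv : nat).
Variables (A : 'I_nv -> 'M[R]_nx) (B : 'I_nv -> 'M[R]_(nx, nu)).
Variables (Q : 'M[R]_nx) (Ru : 'M[R]_nu).

Definition A_of (v : 'cV[R]_nv) : 'M[R]_nx := \sum_i v i 0 *: A i.
Definition B_of (v : 'cV[R]_nv) : 'M[R]_(nx, nu) := \sum_i v i 0 *: B i.

Section on_space.
Context (d : measure_display) (T : measurableType d) (P : probability T R).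
Variables (v : nat -> T -> 'cV[R]_nv) (x0 : T -> 'cV[R]_nx).
Variable u : nat -> T -> 'cV[R]_nu.

Fixpoint state (t : nat) : T -> 'cV[R]_nx :=
  if t is s.+1 then
    fun w => A_of (v s w) *m state s w + B_of (v s w) *m u s w
  else x0.

Definition state_input (t : nat) (w : T) : 'cV[R]_(nx + nu) :=
  col_mx (state t w) (u t w).

Definition slqr_feasible : Prop :=
  forall t, square_integrable P (u t) /\
    independent P (sigma_vec (state_input t)) (sigma_from v t).

Definition stage_cost (t : nat) (w : T) : R :=
  ((state t w)^T *m Q *m state t w + (u t w)^T *m Ru *m u t w) 0 0.

Definition slqr_cost : \bar R :=
  (\int[P]_w \sum_(0 <= t <oo) (stage_cost t w)%:E)%E.

End on_space.

Definition slqr_val (d : measure_display) (T : measurableType d)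
    (P : probability T R) (v : nat -> T -> 'cV[R]_nv) (x0 : T -> 'cV[R]_nx) :
    \bar R :=
  ereal_inf [set c | exists (e : extension P) (u : nat -> e -> 'cV[R]_nu),
    let ve t := v t \o ext_proj e in
    let x0e := x0 \o ext_proj e in
    slqr_feasible (ext_prob e) ve x0e u /\ c = slqr_cost (ext_prob e) ve x0e u].

End SLQR.

Arguments state {R nx nu nv} A B {d T} v x0 u t _.
Arguments state_input {R nx nu nv} A B {d T} v x0 u t _.

Section model.
Context (R : realType) (nx nu nv nw : nat).
Variables (A : 'I_nv -> 'M[R]_nx) (B : 'I_nv -> 'M[R]_(nx, nu)).
Variable M : 'I_nw -> 'M[R]_(nx, nx + nu).

(* vec stacks columns whereas [mxvec] is row-major, so vec(N)^T = mxvec N^T. *)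
Definition M3 : 'M[R]_(nw, (nx + nu) * nx) :=
  \matrix_(k < nw) mxvec (M k)^T.

Definition V3 : 'M[R]_(nv, (nx + nu) * nx) :=
  \matrix_(i < nv) mxvec (row_mx (A i) (B i))^T.

Definition model_noise (v : 'cV[R]_nv) : 'cV[R]_nw :=
  mp_pinv M3^T *m V3^T *m v.

Definition model_equiv : Prop :=
  \rank M3 = \rank (col_mx M3 V3) /\ \rank (col_mx M3 V3) = nw.

Definition calE (W : 'M[R]_nw) (Z : 'M[R]_(nx + nu)) : 'M[R]_nx :=
  \sum_(k < nw) \sum_(l < nw) W k l *: (M k *m Z *m (M l)^T).

Definition lqrcp_feasible (W : 'M[R]_nw) (X0 : 'M[R]_nx)
    (Z : nat -> 'M[R]_(nx + nu)) : Prop :=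
  [/\ forall t, psdmx (Z t),
      ulsubmx (Z 0%N) = X0
    & forall t, ulsubmx (Z t.+1) = calE W (Z t)].

Definition lqrcp_cost (Q : 'M[R]_nx) (Ru : 'M[R]_nu)
    (Z : nat -> 'M[R]_(nx + nu)) : \bar R :=
  (\sum_(0 <= t <oo) (\tr (Z t *m block_mx Q 0 0 Ru))%:E)%E.

Definition lqrcp_val (W : 'M[R]_nw) (X0 : 'M[R]_nx)
    (Q : 'M[R]_nx) (Ru : 'M[R]_nu) : \bar R :=
  ereal_inf [set lqrcp_cost Q Ru Z | Z in lqrcp_feasible W X0].

End model.

(* Main.v *)
Require Import Defs.
From HB Require Import structures.
From mathcomp Require Import all_boot all_order all_algebra.
From mathcomp Require Import all_classical all_reals all_analysis.
From mathcomp Require Import measurable_realfun ring lra.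

(* Taking second moments of the dynamics gives the easy direction: z_t is
   independent of v_t, so E[v_i v_j z z^T] factors, and model equivalence
   rewrites [A_i, B_i] in terms of the M_k, which turns the recursion into
   X_{t+1} = E(Z_t); the costs agree by Tonelli.

   Conversely, positivity of Z_t yields K_t with K_t X_t = V_t^T and a positive
   semidefinite Schur complement U_t - K_t X_t K_t^T = L_t L_t^T.  The feedback
   u_t = K_t x_t + L_t xi_t then has second moments Z_t as soon as the noises
   xi_t are centred, have identity covariance and are uncorrelated with x_t.
   They are realized on the product of T with a discrete space of which the
   noise coordinates charge disjoint pairs of atoms with opposite signs:
   wherever a coordinate of xi_t is nonzero all earlier noises vanish, so x_t
   agrees there with the noise-free state, a function of the T-component. *)

Set Implicit Arguments.
Unset Strict Implicit.
Unset Printing Implicit Defensive.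

Import Order.TTheory GRing.Theory Num.Theory.
Import numFieldNormedType.Exports.

Local Open Scope classical_set_scope.
Local Open Scope ring_scope.

(** * Factorization of positive semidefinite matrices *)

Section psd_factorization.
Context (R : realType).

Lemma dotmx_ge0 n (x : 'cV[R]_n) : 0 <= (x^T *m x) 0 0.
Proof. by rewrite mxE sumr_ge0// => i _; rewrite mxE -expr2 sqr_ge0. Qed.

Lemma dotmx_eq0 n (x : 'cV[R]_n) : (x^T *m x) 0 0 = 0 -> x = 0.
Proof.
rewrite mxE => x0; apply/colP => i; rewrite [RHS]mxE.
have ge0 k : true -> 0 <= x^T 0 k * x k 0 by rewrite mxE -expr2 sqr_ge0.
have := psumr_eq0P ge0 x0 (i := i) isT; rewrite mxE -expr2 => /eqP.
by rewrite sqrf_eq0 => /eqP.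
Qed.

Lemma psdmx_congr m n (S : 'M[R]_n) (C : 'M[R]_(m, n)) :
  psdmx S -> psdmx (C *m S *m C^T).
Proof.
move=> [ST S0]; split; first by rewrite !trmx_mul trmxK ST mulmxA.
by move=> x; have := S0 (C^T *m x); rewrite trmx_mul trmxK !mulmxA.
Qed.

Lemma psdmx_ulsubmx m n (Z : 'M[R]_(m + n)) : psdmx Z -> psdmx (ulsubmx Z).
Proof.
move=> /(psdmx_congr (row_mx 1%:M 0)).
rewrite -{1}(submxK Z) tr_row_mx trmx0 trmx1 mul_row_block mul_row_col.
by rewrite !mul1mx !mul0mx !mulmx0 !addr0 mulmx1.
Qed.

(* If X y = 0, then the form at (y, -e V^T y) is -2e|V^T y|^2 + O(e^2). *)
Lemma psdmx_ker m n (Z : 'M[R]_(m + n)) (y : 'cV[R]_m) :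
  psdmx Z -> ulsubmx Z *m y = 0 -> dlsubmx Z *m y = 0.
Proof.
move=> [ZT Z0] Xy0; set q := dlsubmx Z *m y.
have urE : ursubmx Z = (dlsubmx Z)^T by rewrite trmx_dlsub ZT.
apply: dotmx_eq0; set a := (q^T *m q) 0 0.
set c := (q^T *m drsubmx Z *m q) 0 0.
have addE (S1 S2 : 'M[R]_1) : (S1 + S2) 0 0 = S1 0 0 + S2 0 0 by rewrite mxE.
have scaleE k (S1 : 'M[R]_1) : (k *: S1) 0 0 = k * S1 0 0 by rewrite mxE.
have key e : 0 <= - (2 * e * a) + e ^+ 2 * c.
  have := Z0 (col_mx y (- e *: q)).
  rewrite -{1}(submxK Z) tr_col_mx mul_row_block mul_row_col mulmxDl.
  rewrite -(mulmxA y^T) Xy0 mulmx0 add0r urE.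
  rewrite -trmx_mul -/q -(mulmxA _ _ y) -/q mulmxDl.
  rewrite linearZ /= -!scalemxAl -!scalemxAr scalerA !addE !scaleE -/a -/c => h.
  by apply: le_trans h _; rewrite le_eqVlt; apply/orP; left; apply/eqP; ring.
have a0 : 0 <= a := dotmx_ge0 q.
have c0 : 0 <= c.
  have := Z0 (col_mx 0 q); rewrite -{1}(submxK Z) tr_col_mx mul_row_block.
  by rewrite mul_row_col trmx0 !mul0mx !add0r mulmx0 add0r.
apply/eqP; rewrite eq_le a0 andbT leNgt; apply/negP => agt0.
(* With e = a / (c + 1) the bound [key] becomes 0 <= - e^2 (c + 2), which is absurd; adding 1 keeps
   the denominator positive when c = 0. *)
have c1 : 0 < c + 1 by lra.
have := key (a / (c + 1)); apply/negP; rewrite -ltNge.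
have -> : - (2 * (a / (c + 1)) * a) + (a / (c + 1)) ^+ 2 * c =
    - ((a / (c + 1)) ^+ 2 * (c + 2)).
  by field; rewrite gt_eqF.
by rewrite oppr_lt0 mulr_gt0 ?exprn_gt0 ?divr_gt0//; lra.
Qed.

(** The block X may be singular, so K cannot be V^T X^-1. By [psdmx_ker] the kernel of X lies in
    that of V^T, hence V^T factors through X. The Schur complement is then the congruence of Z by
    [-K, I]. *)
Lemma psdmx_schur m n (Z : 'M[R]_(m + n)) : psdmx Z ->
  exists2 K : 'M[R]_(n, m), K *m ulsubmx Z = dlsubmx Z &
    psdmx (drsubmx Z - K *m ulsubmx Z *m K^T).
Proof.
move=> psdZ; have [ZT Z0] := psdZ.
have urE : ursubmx Z = (dlsubmx Z)^T by rewrite trmx_dlsub ZT.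
have XT : (ulsubmx Z)^T = ulsubmx Z by rewrite trmx_ulsub ZT.
(* Row-space inclusion is tested on the columns of the cokernel matrix of X, each of which X
   annihilates. *)
have : (dlsubmx Z <= ulsubmx Z)%MS.
  rewrite submxE; apply/eqP/matrixP => i j.
  have : dlsubmx Z *m col j (cokermx (ulsubmx Z)) = 0.
    apply: psdmx_ker => //.
    by rewrite colE mulmxA mulmx_coker mul0mx.
  by rewrite colE mulmxA -colE => /colP/(_ i); rewrite !mxE.
move=> /submxP[K KE]; exists K => //.
have := psdmx_congr (row_mx (- K) 1%:M) psdZ.
rewrite -{1}(submxK Z) mul_row_block tr_row_mx mul_row_col !mul1mx trmx1 mulmx1.
rewrite mulNmx -KE addNr mul0mx add0r urE KE trmx_mul XT mulNmx addrC.
by rewrite mulmxA.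
Qed.

(** Cholesky factorization by induction on the size: split off the top-left scalar and factor its
    Schur complement. *)
Lemma psdmx_gram n (S : 'M[R]_n) :
  psdmx S -> exists L : 'M[R]_n, S = L *m L^T.
Proof.
elim: n S => [|n IHn] S psdS; first by exists 0; rewrite flatmx0 [RHS]flatmx0.
have [K KE] := @psdmx_schur 1 n S psdS.
move=> /IHn[L LE].
have [ST _] := psdS.
pose a := @ulsubmx _ 1 n 1 n S.
have a0 : 0 <= a 0 0.
  have [_ a0] := @psdmx_ulsubmx 1 n S psdS; have := a0 1%:M.
  by rewrite trmx1 mul1mx mulmx1.
pose r : 'M[R]_1 := (Num.sqrt (a 0 0))%:M.
have rr : r *m r = a.
  by rewrite /r mul_scalar_mx scale_scalar_mx -expr2 sqr_sqrtr// [RHS]mx11_scalar.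
(* Since K a is the lower-left block, K r plays the role of that block divided by r = sqrt a, also
   when the pivot a is zero. *)
exists (block_mx r 0 (K *m r) L : 'M[R]_(1 + n)).
have rT : r^T = r by rewrite /r tr_scalar_mx.
rewrite -[LHS](@submxK _ 1 n 1 n).
rewrite (@tr_block_mx _ 1 n 1 n) (@mulmx_block _ 1 n 1 n 1 n) !trmx0.
rewrite !mulmx0 !mul0mx !addr0 trmx_mul rT rr.
rewrite -(mulmxA K r r) rr KE.
rewrite (mulmxA r r) rr -/a.
rewrite (mulmxA (K *m r)) -(mulmxA K r r) rr -LE.
have aT : a^T = a by rewrite [a]mx11_scalar tr_scalar_mx.
have -> : a *m K^T = @ursubmx _ 1 n 1 n S.
  by rewrite -{1}aT -trmx_mul KE trmx_dlsub ST.
by rewrite addrCA subrr addr0.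
Qed.

End psd_factorization.

(** * Expressing the system matrices through the model matrices *)

Section model_equivalence.
Context (R : realType) (nx nu nv nw : nat).
Variables (A : 'I_nv -> 'M[R]_nx) (B : 'I_nv -> 'M[R]_(nx, nu)).
Variable M : 'I_nw -> 'M[R]_(nx, nx + nu).

(** The matrix that sends v_t to w_t. Under model equivalence its column i also holds the
    coefficients of [A_i, B_i] in the M_k. *)
Definition model_coef : 'M[R]_(nw, nv) := mp_pinv (M3 M)^T *m (V3 A B)^T.

(** Stacking [V3] below [M3] does not raise the rank, so the rows of [V3] lie in the row space of
    [M3]. On the range of [M3^T] the first Penrose equation makes the pseudo-inverse a right
    inverse, which gives [M3^T *m model_coef = V3^T]. *)
Lemma model_equivE : model_equiv A B M ->
  forall i, row_mx (A i) (B i) = \sum_k model_coef k i *: M k.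
Proof.
move=> [rk _] i.
have : (V3 A B <= M3 M)%MS.
  have := submx_refl (col_mx (M3 M) (V3 A B)); rewrite col_mx_sub => /andP[].
  move=> /mxrank_leqif_sup[_]; rewrite {1}rk eqxx => /esym ssub s.
  exact: submx_trans s ssub.
move=> /submxP[D VD].
have [MMM _ _ _] := mp_pinvP (M3 M)^T.
have VE : (M3 M)^T *m model_coef = (V3 A B)^T.
  by rewrite /model_coef VD trmx_mul !mulmxA MMM.
have {}VE : V3 A B = model_coef^T *m M3 M.
  by rewrite -[LHS]trmxK -VE trmx_mul trmxK.
apply: trmx_inj; apply: (can_inj mxvecK).
have := congr1 (row i) VE; rewrite rowK => ->.
rewrite row_mul mulmx_sum_row linear_sum/= linear_sum/=.
by apply: eq_bigr => k _; rewrite rowK !linearZ/= !mxE.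
Qed.

End model_equivalence.

(** * Means and independent functions *)

Section mean.
Context (R : realType) (d : measure_display) (T : measurableType d).
Variable P : probability T R.
Implicit Types f g : T -> R.

Definition mean f : R := fine 'E_P[f].

Lemma Lfun_measurable p f : f \in Lfun P p -> measurable_fun setT f.
Proof. by move=> /sub_Lfun_mfun; rewrite inE. Qed.

Lemma meanE f : f \in Lfun P 1 -> ('E_P[f] = (mean f)%:E)%E.
Proof. by move=> fL; rewrite fineK// expectation_fin_num. Qed.

Lemma Lfun1D f g : f \in Lfun P 1 -> g \in Lfun P 1 ->
  (fun w => f w + g w) \in Lfun P 1.
Proof.
move=> /Lfun1_integrable fL /Lfun1_integrable gL; apply/Lfun1_integrable.
exact: (integrableD measurableT fL gL).
Qed.

Lemma Lfun1Z k f : f \in Lfun P 1 -> (fun w => k * f w) \in Lfun P 1.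
Proof.
move=> /Lfun1_integrable fL; apply/Lfun1_integrable.
exact: (integrableZl measurableT k fL).
Qed.

Lemma meanD f g : f \in Lfun P 1 -> g \in Lfun P 1 ->
  mean (fun w => f w + g w) = mean f + mean g.
Proof.
move=> fL gL; apply: EFin_inj.
rewrite -meanE ?Lfun1D// EFinD -!meanE// unlock.
by under eq_integral do rewrite EFinD; rewrite integralD//; exact/Lfun1_integrable.
Qed.

Lemma meanZ k f : f \in Lfun P 1 -> mean (fun w => k * f w) = k * mean f.
Proof.
move=> fL; apply: EFin_inj; rewrite -meanE ?Lfun1Z// EFinM -!meanE// unlock.
under eq_integral do rewrite EFinM.
by rewrite integralZl//; exact/Lfun1_integrable.
Qed.

Lemma mean0 : mean (fun=> 0) = 0.
Proof. by rewrite /mean expectation_cst. Qed.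

Lemma Lfun1_sum (I : Type) (s : seq I) (f : I -> T -> R) :
  (forall i, f i \in Lfun P 1) -> (fun w => \sum_(i <- s) f i w) \in Lfun P 1.
Proof.
move=> fL; elim: s => [|i s IHs].
  by under eq_fun do rewrite big_nil; exact: Lfun_cst.
by under eq_fun do rewrite big_cons; exact: Lfun1D.
Qed.

Lemma mean_sum (I : Type) (s : seq I) (f : I -> T -> R) :
  (forall i, f i \in Lfun P 1) ->
  mean (fun w => \sum_(i <- s) f i w) = \sum_(i <- s) mean (f i).
Proof.
move=> fL; elim: s => [|i s IHs].
  by under eq_fun do rewrite big_nil; rewrite big_nil mean0.
under eq_fun do rewrite big_cons.
by rewrite meanD ?IHs ?big_cons// Lfun1_sum.
Qed.

Lemma mean_ge0 f : (forall w, 0 <= f w) -> 0 <= mean f.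
Proof. by move=> f0; rewrite fine_ge0// expectation_ge0. Qed.

Lemma Lfun2P f : f \in Lfun P 2%:E <->
  measurable_fun setT f /\ (fun w => f w ^+ 2) \in Lfun P 1.
Proof.
split=> [fL|[mf /Lfun1_integrable/integrableP[_ ff]]].
  split; first exact: Lfun_measurable fL.
  exact/Lfun1_integrable/Lfun2_integrable_sqr.
rewrite inE; apply/andP; split; rewrite inE//=.
rewrite /finite_norm unlock /Lnorm poweR_lty//.
apply: le_lt_trans ff; rewrite le_eqVlt; apply/orP; left; apply/eqP/eq_integral => x _ /=.
by rewrite powR_mulrn// normrX.
Qed.

Lemma Lfun2M f g : f \in Lfun P 2%:E -> g \in Lfun P 2%:E ->
  (fun w => f w * g w) \in Lfun P 1.
Proof. exact: Lfun2_mul_Lfun1. Qed.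

Lemma Lfun2D f g : f \in Lfun P 2%:E -> g \in Lfun P 2%:E ->
  (fun w => f w + g w) \in Lfun P 2%:E.
Proof.
move=> fL gL; apply/Lfun2P; split.
  by apply: measurable_funD; [exact: Lfun_measurable fL|exact: Lfun_measurable gL].
rewrite (_ : (fun w => _) = fun w => (f w * f w + f w * g w) +
    (f w * g w + g w * g w)); last by apply/funext => w; ring.
by rewrite !Lfun1D// Lfun2M.
Qed.

Lemma Lfun2Z k f : f \in Lfun P 2%:E -> (fun w => k * f w) \in Lfun P 2%:E.
Proof.
move=> fL; apply/Lfun2P; split.
  by apply: measurable_funM => //; exact: Lfun_measurable fL.
under eq_fun do rewrite exprMn; apply: Lfun1Z.
by have [] := (Lfun2P f).1 fL.
Qed.

Lemma Lfun2_sum (I : Type) (s : seq I) (f : I -> T -> R) :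
  (forall i, f i \in Lfun P 2%:E) ->
  (fun w => \sum_(i <- s) f i w) \in Lfun P 2%:E.
Proof.
move=> fL; elim: s => [|i s IHs].
  by under eq_fun do rewrite big_nil; exact: Lfun_cst.
by under eq_fun do rewrite big_cons; exact: Lfun2D.
Qed.

End mean.

(** * Products of independent integrable functions *)

Section independent_functions.
Context (R : realType) (d : measure_display) (T : measurableType d).
Variable P : probability T R.
Variables f g : T -> R.
Hypotheses (mf : measurable_fun setT f) (mg : measurable_fun setT g).
Hypothesis fg : forall A B : set R, measurable A -> measurable B ->
  P (f @^-1` A `&` g @^-1` B) = (P (f @^-1` A) * P (g @^-1` B))%E.

HB.instance Definition _ := @isMeasurableFun.Build _ _ _ _ f mf.
HB.instance Definition _ := @isMeasurableFun.Build _ _ _ _ g mg.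
Let h w : R * R := (f w, g w).
Let mh : measurable_fun setT h. Proof. exact: measurable_fun_pair. Qed.
HB.instance Definition _ := @isMeasurableFun.Build _ _ _ _ h mh.

(** Hypothesis [fg] is this equality on rectangles, and a product measure is determined by its
    values there. *)
Let joint_law A : measurable A ->
  (distribution P f \x distribution P g)%E A = distribution P h A.
Proof. exact: product_measure_unique. Qed.

Let mulf (x : R * R) : \bar R := (x.1 * x.2)%:E.

Let mmulf : measurable_fun setT mulf.
Proof. by apply/measurable_EFinP; apply: measurable_funM. Qed.

Hypotheses (f1 : f \in Lfun P 1) (g1 : g \in Lfun P 1).

(** By Tonelli the integral of |x y| splits into the product of two finite absolute first
    moments. *)
Let imulf :
  (distribution P f \x distribution P g)%E.-integrable setT mulf.
Proof.
apply: (@integrable12ltyP _ _ _ _ _ (distribution P f) (distribution P g) _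
  mmulf).2.
have /Lfun1_integrable/integrableP[_ fi] := f1.
have /Lfun1_integrable/integrableP[_ gi] := g1.
rewrite (eq_integral (fun x : R => `|x%:E| *
   \int[distribution P g]_y `|y%:E|)%E); last first.
  move=> x _; rewrite -ge0_integralZl//; last exact: measurableT_comp.
  by apply: eq_integral => y _; rewrite /mulf/= normrM EFinM.
rewrite ge0_integralZr//; last 2 first.
- exact: measurableT_comp.
- exact: integral_ge0.
rewrite !ge0_integral_distribution//; try exact: measurableT_comp.
have fi0 : (0 <= \int[P]_w ((fun y : R => `|y%:E|) \o f) w)%E.
  by apply: integral_ge0 => x _ /=; rewrite lee_fin.
by rewrite lte_mul_pinfty// ge0_fin_numE.
Qed.

Lemma Lfun1M_indep : (fun w => f w * g w) \in Lfun P 1.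
Proof.
apply/Lfun1_integrable/integrableP; split.
  by apply/measurable_EFinP; exact: measurable_funM.
have /integrableP[_] := imulf.
rewrite (eq_measure_integral (distribution P h)); last first.
  by move=> A mA _; exact: joint_law.
by rewrite ge0_integral_distribution//; exact: measurableT_comp.
Qed.

Lemma meanM_indep : mean P (fun w => f w * g w) = mean P f * mean P g.
Proof.
apply: EFin_inj; rewrite EFinM -!meanE// ?Lfun1M_indep// unlock.
have /Lfun1_integrable fi := f1.
have /Lfun1_integrable gi := g1.
rewrite [LHS](_ : _ = \int[distribution P h]_x mulf x)%E; last first.
  rewrite integral_distribution//.
  exact/Lfun1_integrable/Lfun1M_indep.
rewrite (eq_measure_integral (distribution P f \x distribution P g)%E); last first.
  by move=> A mA _; exact/esym/joint_law.
rewrite -integral12_prod_meas1// /fubini_F.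
have fEi : (distribution P f).-integrable setT EFin.
  exact: integrable_pushforward.
have gEi : (distribution P g).-integrable setT EFin.
  exact: integrable_pushforward.
rewrite (eq_integral (fun x : R => x%:E * \int[distribution P g]_y y%:E)%E); last first.
  by move=> x _; rewrite -integralZl//; under eq_integral do rewrite EFinM.
have gfin : (\int[distribution P g]_y y%:E)%E \is a fin_num.
  exact: integrable_fin_num gEi.
by rewrite -(fineK gfin) integralZr// (fineK gfin) !integral_distribution.
Qed.

End independent_functions.

(** * Integrability and means depend only on the law *)

Section law.
Context (R : realType).
Context (d : measure_display) (T : measurableType d) (P : probability T R).
Context (d' : measure_display) (T' : measurableType d') (P' : probability T' R).
Variables (f : T -> R) (g : T' -> R).
Hypotheses (mf : measurable_fun setT f) (mg : measurable_fun setT g).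
Hypothesis fg : forall A : set R, measurable A -> P (f @^-1` A) = P' (g @^-1` A).

HB.instance Definition _ := @isMeasurableFun.Build _ _ _ _ f mf.
HB.instance Definition _ := @isMeasurableFun.Build _ _ _ _ g mg.

Lemma Lfun1_law : f \in Lfun P 1 -> g \in Lfun P' 1.
Proof.
move=> /Lfun1_integrable/integrableP[_ fi].
apply/Lfun1_integrable/integrableP; split; first exact/measurable_EFinP.
move: fi; rewrite -(@ge0_integral_distribution _ _ _ _ _ P f (fun x : R => `|x%:E|%E))//; last first.
  exact: measurableT_comp.
rewrite (eq_measure_integral (distribution P' g)); last first.
  by move=> A mA _; exact: fg.
by rewrite ge0_integral_distribution//; exact: measurableT_comp.
Qed.

Lemma mean_law : f \in Lfun P 1 -> mean P f = mean P' g.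
Proof.
move=> f1; have g1 := Lfun1_law f1.
rewrite /mean unlock; congr fine.
rewrite -(@integral_distribution _ _ _ _ _ P f EFin)//; last exact/Lfun1_integrable.
rewrite (eq_measure_integral (distribution P' g)); last first.
  by move=> A mA _; exact: fg.
by rewrite integral_distribution//; exact/Lfun1_integrable.
Qed.

End law.

(** * Independence of past and future *)

Section generated_sigma_algebras.
Context (R : realType).

Lemma sigma_vec_preimage d (T : measurableType d) n (X : T -> 'cV[R]_n) i (B : set R) :
  measurable B -> sigma_vec X ((fun w => X w i 0) @^-1` B).
Proof.
move=> mB; apply: sub_sigma_algebra.
rewrite (bigD1 i)//=; left.
by exists B => //; rewrite setTI.
Qed.

Lemma sigma_vec_sub d (T : measurableType d) n (X : T -> 'cV[R]_n) (S : set (set T)) :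
  sigma_algebra setT S ->
  (forall i (B : set R), measurable B -> S ((fun w => X w i 0) @^-1` B)) ->
  sigma_vec X `<=` S.
Proof.
move=> SA SX; apply: smallest_sub => //.
apply: (big_ind (fun U => U `<=` S)) => //.
  by move=> U V US VS A [/US|/VS].
by move=> i _ _ [B mB <-]; rewrite setTI; exact: SX.
Qed.

Lemma sigma_vec_measurable d (T : measurableType d) n (X : T -> 'cV[R]_n) :
  random_vector X -> sigma_vec X `<=` measurable.
Proof.
move=> mX; apply: sigma_vec_sub; first exact: sigma_algebra_measurable.
by move=> i B mB; rewrite -[_ @^-1` _]setTI; exact: mX.
Qed.

Lemma sigma_vecT d (T : measurableType d) n (X : T -> 'cV[R]_n) : sigma_vec X setT.
Proof.
have [S0 SC _] := smallest_sigma_algebra (setT : set T)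
  (\big[setU/set0]_(i < n) preimage_set_system setT (fun w => X w i 0) measurable).
by have := SC _ S0; rewrite setD0.
Qed.

Lemma sigma_vecI d (T : measurableType d) n (X : T -> 'cV[R]_n) (E F : set T) :
  sigma_vec X E -> sigma_vec X F -> sigma_vec X (E `&` F).
Proof.
set G := \big[setU/set0]_(i < n) preimage_set_system setT (fun w => X w i 0) measurable.
exact: (@measurableI _ (g_sigma_algebraType G)).
Qed.

Lemma sigma_from_sub d (T : measurableType d) n (v : nat -> T -> 'cV[R]_n) t :
  (forall s, random_vector (v s)) -> sigma_from v t `<=` measurable.
Proof.
move=> mv; apply: smallest_sub; first exact: sigma_algebra_measurable.
by move=> A [s _]; exact: sigma_vec_measurable.
Qed.

Lemma sigma_from_ge d (T : measurableType d) n (v : nat -> T -> 'cV[R]_n) t s :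
  (t <= s)%N -> sigma_vec (v s) `<=` sigma_from v t.
Proof. by move=> ts A vA; apply: sub_sigma_algebra; exists s. Qed.

Lemma sigma_vec_comp d' (T' : measurableType d')
    d (T : measurableType d) n (X : T -> 'cV[R]_n)
    (p : T' -> T) (E : set T') :
  sigma_vec (X \o p) E -> exists2 F, sigma_vec X F & E = p @^-1` F.
Proof.
rewrite /sigma_vec (g_sigma_preimage_comp (fun (i : 'I_n) w => X w i 0) p).
by move=> [F XF <-]; exists F => //; rewrite setTI.
Qed.

(** The preimages under p of the events of [sigma_from v t] form a sigma-algebra containing the
    generators. Future events of an extension are thereby pulled back from the given space. *)
Lemma sigma_from_comp d' (T' : measurableType d')
    d (T : measurableType d) n (v : nat -> T -> 'cV[R]_n)
    (p : T' -> T) t (E : set T') :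
  sigma_from (fun s => v s \o p) t E ->
  exists2 F, sigma_from v t F & E = p @^-1` F.
Proof.
suff sub : sigma_from (fun s => v s \o p) t `<=`
    preimage_set_system setT p (sigma_from v t).
  by move=> /sub[F vF <-]; exists F => //; rewrite setTI.
apply: smallest_sub.
  exact/sigma_algebra_preimage/smallest_sigma_algebra.
move=> A [s /= ts] /sigma_vec_comp[F vF ->].
by exists F; [exact: (sigma_from_ge ts)|rewrite setTI].
Qed.

End generated_sigma_algebras.

Section independence.
Context (R : realType) (d : measure_display) (T : measurableType d).
Variable P : probability T R.

Lemma independent_sym (F G : set (set T)) :
  independent P F G -> independent P G F.
Proof. by move=> FG E1 E2 G1 F2; rewrite setIC FG// muleC. Qed.

Lemma independent_sub (F F' G G' : set (set T)) :
  F' `<=` F -> G' `<=` G -> independent P F G -> independent P F' G'.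
Proof. by move=> FF GG FG E1 E2 /FF F1 /GG; exact: FG. Qed.

(** For fixed E2 in H, the finite measures P(. & E2) and P(E2) P(.) agree on the pi-system G, hence
    on the sigma-algebra it generates. *)
Lemma independent_sigma_l (G H : set (set T)) :
  G `<=` measurable -> setI_closed G -> G setT -> H `<=` measurable ->
  independent P G H -> independent P <<s G>> H.
Proof.
move=> Gm GI GT Hm GH E1 E2 G1 H2.
have p0 : 0 <= fine (P E2) by rewrite fine_ge0.
(* Scaling a measure takes a nonnegative real factor, whence the [fine] of P(E2), which is
   finite. *)
pose m2 : {measure set T -> \bar R} := mscale (NngNum p0) P.
have PE : P E2 = (fine (P E2))%:E by rewrite fineK// fin_num_measure//; exact: Hm.
have -> : (P (E1 `&` E2) = mrestr P (Hm _ H2) E1)%E by [].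
have -> : (P E1 * P E2 = m2 E1)%E by rewrite muleC [X in (X * _)%E]PE.
apply: (g_sigma_algebra_measure_unique G Gm (fun=> setT)) => //.
- by rewrite bigcup_const//; exists 0%N.
- by move=> A GA; rewrite /m2 /mscale/= /mrestr GH// muleC [X in (X * _)%E]PE.
- move=> _; rewrite [ltLHS](_ : _ = P E2).
    by rewrite -ge0_fin_numE// fin_num_measure//; exact: Hm.
  by rewrite /= /mrestr setTI.
Qed.

Lemma independent_sigma (G H : set (set T)) :
  G `<=` measurable -> setI_closed G -> G setT ->
  H `<=` measurable -> setI_closed H -> H setT ->
  independent P G H -> independent P <<s G>> <<s H>>.
Proof.
move=> Gm GI GT Hm HI HT GH.
apply: independent_sigma_l => //.
  by apply: smallest_sub => //; exact: sigma_algebra_measurable.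
by apply/independent_sym/independent_sigma_l => //; exact: independent_sym.
Qed.

Section past_future.
Context (n m : nat) (v : nat -> T -> 'cV[R]_n) (x : T -> 'cV[R]_m).
Hypotheses (mv : forall t, random_vector (v t)) (mx : random_vector x).
Hypothesis v_indep : mutually_independent P v.
Hypothesis xv_indep : independent P (sigma_vec x) (sigma_from v 0).

(** Generators only: the past at time t is the sigma-algebra [<<s past_gen t>>] of x and v_0, ...,
    v_(t-1). *)
Definition past_gen t : set (set T) :=
  sigma_vec x `|` \bigcup_(s in `I_t) sigma_vec (v s).

Let events (E : nat -> set T) := forall s, sigma_vec (v s) (E s).

Let eventsI E F : events E -> events F -> events (fun s => E s `&` F s).
Proof. by move=> vE vF s; exact: sigma_vecI. Qed.

(** Factors equal to [setT] drop out of the intersection, leaving finitely many to which mutual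
    independence applies. *)
Let cylinder_prob E k : events E -> (forall s, (k <= s)%N -> E s = setT) ->
  P (\bigcap_s E s) = (\prod_(s < k) P (E s))%E.
Proof.
move=> vE Ek; rewrite -(big_mkord xpredT (fun s => P (E s))) /index_iota subn0.
rewrite -v_indep ?iota_uniq//; congr (P _).
apply/seteqP; split=> [w Ew s _|w Ew s _]; first exact: Ew.
have [/Ek ->//|sk] := leqP k s.
by apply: Ew => /=; rewrite mem_iota.
Qed.

Let cylinder_from E : events E -> sigma_from v 0 (\bigcap_s E s).
Proof.
move=> vE.
apply: (@bigcapT_measurable _ (g_sigma_algebraType
  (\bigcup_(s in [set s | (0 <= s)%N]) sigma_vec (v s)))) => s.
exact: (sigma_from_ge (leq0n s) (vE s)).
Qed.

(** Unlike [past_gen], these cylinders are closed under intersection. Indexing the factors by all of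
    [nat], trivial ones included, lets two cylinders be intersected factor by factor. *)
Let past t : set (set T) := [set X | exists A E, [/\ sigma_vec x A, events E,
  forall s, (t <= s)%N -> E s = setT & X = A `&` \bigcap_s E s]].

Let future t : set (set T) := [set X | exists k E, [/\ events E,
  forall s, (s < t)%N -> E s = setT, forall s, (k <= s)%N -> E s = setT &
  X = \bigcap_s E s]].

(** Independence of x from the whole noise splits off A. In the remaining product over s < max(t,
    k), at each s either the past factor or the future factor is trivial. *)
Let past_future t : independent P (past t) (future t).
Proof.
move=> _ _ [A [E [xA vE Et ->]]] [k [F [vF Ft Fk ->]]].
rewrite -setIA -bigcapI.
rewrite [LHS]xv_indep//; last first.
  by apply: cylinder_from; apply: eventsI.
rewrite [P (A `&` _)]xv_indep//; last exact: cylinder_from.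
rewrite -muleA; congr (_ * _)%E.
rewrite (@cylinder_prob _ (maxn t k)); last 2 first.
- exact: eventsI.
- by move=> s; rewrite geq_max => /andP[/Et -> /Fk ->]; rewrite setIT.
rewrite (@cylinder_prob E (maxn t k))//; last first.
  by move=> s; rewrite geq_max => /andP[/Et ->].
rewrite (@cylinder_prob F (maxn t k))//; last first.
  by move=> s; rewrite geq_max => /andP[_ /Fk ->].
rewrite -big_split/=; apply: eq_bigr => s _.
have [/Et ->|/Ft ->] := leqP t s.
  by rewrite setTI probability_setT mul1e.
by rewrite setIT probability_setT mule1.
Qed.

Let single (s : nat) (A : set T) (r : nat) : set T := if r == s then A else setT.

Let events_single s A : sigma_vec (v s) A -> events (single s A).
Proof.
by move=> vA r; rewrite /single; case: eqP => [->//|_]; exact: sigma_vecT.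
Qed.

Let bigcap_single s A : \bigcap_r single s A r = A.
Proof.
apply/seteqP; split=> [w /(_ s I)|w Aw r _]; rewrite /single ?eqxx//.
by case: eqP.
Qed.

(** The cylinder families are pi-systems containing the generators of the past and of the future, so
    [past_future] extends to the generated sigma-algebras. *)
Lemma independent_past_future t :
  independent P <<s past_gen t>> (sigma_from v t).
Proof.
apply: (independent_sub _ _ (@independent_sigma (past t) (future t) _ _ _ _ _ _ _)).
- apply: smallest_sub; first exact: smallest_sigma_algebra.
  move=> A [xA|[s /= st vA]]; apply: sub_sigma_algebra.
    exists A, (fun=> setT); split=> //; first by move=> s; exact: sigma_vecT.
    by rewrite bigcapT// setIT.
  exists setT, (single s A); split; first exact: sigma_vecT.
  - exact: events_single.
  - by move=> r tr; rewrite /single gtn_eqF// (leq_trans st).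
  - by rewrite bigcap_single setTI.
- apply: smallest_sub; first exact: smallest_sigma_algebra.
  move=> A [s /= ts vA]; apply: sub_sigma_algebra.
  exists s.+1, (single s A); split; first exact: events_single.
  - by move=> r rt; rewrite /single ltn_eqF// (leq_trans rt).
  - by move=> r tr; rewrite /single gtn_eqF.
  - by rewrite bigcap_single.
- move=> _ [A [E [xA vE Et ->]]]; apply: measurableI.
    exact: sigma_vec_measurable xA.
  by apply: bigcapT_measurable => s; exact: sigma_vec_measurable (vE s).
- move=> _ _ [A [E [xA vE Et ->]]] [B [F [xB vF Ft ->]]].
  exists (A `&` B), (fun s => E s `&` F s); split; first exact: sigma_vecI.
  - exact: eventsI.
  - by move=> s ts; rewrite Et// Ft// setIT.
  - by rewrite bigcapI setIACA.
- exists setT, (fun=> setT); split=> //; first exact: sigma_vecT.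
    by move=> s; exact: sigma_vecT.
  by rewrite bigcapT// setIT.
- move=> _ [k [E [vE Et Ek ->]]].
  by apply: bigcapT_measurable => s; exact: sigma_vec_measurable (vE s).
- move=> _ _ [k [E [vE Et Ek ->]]] [l [F [vF Ft Fl ->]]].
  exists (maxn k l), (fun s => E s `&` F s); split; first exact: eventsI.
  - by move=> s ts; rewrite Et// Ft// setIT.
  - by move=> s; rewrite geq_max => /andP[/Ek -> /Fl ->]; rewrite setIT.
  - by rewrite bigcapI.
- exists 0%N, (fun=> setT); split=> //; first by move=> s; exact: sigma_vecT.
  by rewrite bigcapT//.
- exact: past_future.
Qed.

End past_future.

End independence.

(** * Second moments and dynamics *)

Section second_moments.
Context (R : realType) (d : measure_display) (T : measurableType d).
Variable P : probability T R.

Definition cross_moment m n (X : T -> 'cV[R]_m) (Y : T -> 'cV[R]_n) :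
    'M[R]_(m, n) :=
  \matrix_(i, j) mean P (fun w => X w i 0 * Y w j 0).

Lemma second_momentE n (X : T -> 'cV[R]_n) :
  second_moment P X = cross_moment X X.
Proof. by []. Qed.

Lemma tr_cross_moment m n (X : T -> 'cV[R]_m) (Y : T -> 'cV[R]_n) :
  (cross_moment X Y)^T = cross_moment Y X.
Proof. by apply/matrixP => i j; rewrite !mxE; under eq_fun do rewrite mulrC. Qed.

Lemma square_integrable_rv n (X : T -> 'cV[R]_n) :
  square_integrable P X -> random_vector X.
Proof. by move=> sX i; exact: Lfun_measurable (sX i). Qed.

Lemma square_integrableM m n (C : 'M[R]_(m, n)) (X : T -> 'cV[R]_n) :
  square_integrable P X -> square_integrable P (fun w => C *m X w).
Proof.
move=> sX i; under eq_fun do rewrite mxE.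
by apply: Lfun2_sum => j; exact/Lfun2Z/sX.
Qed.

Lemma square_integrableD n (X Y : T -> 'cV[R]_n) :
  square_integrable P X -> square_integrable P Y ->
  square_integrable P (fun w => X w + Y w).
Proof.
by move=> sX sY i; under eq_fun do rewrite mxE; exact: Lfun2D (sX i) (sY i).
Qed.

Lemma square_integrable_sum (I : Type) (s : seq I) n (X : I -> T -> 'cV[R]_n) :
  (forall i, square_integrable P (X i)) ->
  square_integrable P (fun w => \sum_(i <- s) X i w).
Proof.
move=> sX i; under eq_fun do rewrite summxE.
by apply: Lfun2_sum => j; exact: sX.
Qed.

Lemma square_integrable_col m n (X : T -> 'cV[R]_m) (Y : T -> 'cV[R]_n) :
  square_integrable P X -> square_integrable P Y ->
  square_integrable P (fun w => col_mx (X w) (Y w)).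
Proof.
move=> sX sY i; case: (split_ordP i) => j ->.
  by under eq_fun do rewrite col_mxEu; exact: sX.
by under eq_fun do rewrite col_mxEd; exact: sY.
Qed.

Lemma cross_momentMl p m n (C : 'M[R]_(p, m)) (X : T -> 'cV[R]_m)
    (Y : T -> 'cV[R]_n) : square_integrable P X -> square_integrable P Y ->
  cross_moment (fun w => C *m X w) Y = C *m cross_moment X Y.
Proof.
move=> sX sY; apply/matrixP => i j; rewrite !mxE.
have XY k : (fun w => X w k 0 * Y w j 0) \in Lfun P 1 by exact: Lfun2M.
transitivity (mean P (fun w => \sum_k C i k * (X w k 0 * Y w j 0))).
  congr mean; apply/funext => w; rewrite mxE mulr_suml.
  by under eq_bigr do rewrite -mulrA.
rewrite mean_sum; last by move=> k; exact: Lfun1Z.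
by apply: eq_bigr => k _; rewrite meanZ// mxE.
Qed.

Lemma cross_momentMr p m n (C : 'M[R]_(p, n)) (X : T -> 'cV[R]_m)
    (Y : T -> 'cV[R]_n) : square_integrable P X -> square_integrable P Y ->
  cross_moment X (fun w => C *m Y w) = cross_moment X Y *m C^T.
Proof.
move=> sX sY; rewrite -tr_cross_moment cross_momentMl//.
by rewrite trmx_mul tr_cross_moment.
Qed.

Lemma cross_momentDl m n (X X' : T -> 'cV[R]_m) (Y : T -> 'cV[R]_n) :
  square_integrable P X -> square_integrable P X' -> square_integrable P Y ->
  cross_moment (fun w => X w + X' w) Y = cross_moment X Y + cross_moment X' Y.
Proof.
move=> sX sX' sY; apply/matrixP => i j; rewrite !mxE -meanD ?Lfun2M//.
by congr mean; apply/funext => w; rewrite mxE mulrDl.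
Qed.

Lemma cross_momentDr m n (X : T -> 'cV[R]_m) (Y Y' : T -> 'cV[R]_n) :
  square_integrable P X -> square_integrable P Y -> square_integrable P Y' ->
  cross_moment X (fun w => Y w + Y' w) = cross_moment X Y + cross_moment X Y'.
Proof.
move=> sX sY sY'; rewrite -tr_cross_moment cross_momentDl// linearD/=.
by rewrite !tr_cross_moment.
Qed.

Lemma cross_moment_suml (I : Type) (s : seq I) m n (X : I -> T -> 'cV[R]_m)
    (Y : T -> 'cV[R]_n) :
  (forall i, square_integrable P (X i)) -> square_integrable P Y ->
  cross_moment (fun w => \sum_(i <- s) X i w) Y =
  \sum_(i <- s) cross_moment (X i) Y.
Proof.
move=> sX sY; elim: s => [|i s IHs].
  under [X in cross_moment X]eq_fun do rewrite big_nil.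
  rewrite big_nil; apply/matrixP => i j; rewrite !mxE.
  by under eq_fun do rewrite mul0r; rewrite mean0.
under [X in cross_moment X]eq_fun do rewrite big_cons.
by rewrite cross_momentDl ?IHs ?big_cons//; exact: square_integrable_sum.
Qed.

Lemma cross_moment_sumr (I : Type) (s : seq I) m n (X : T -> 'cV[R]_m)
    (Y : I -> T -> 'cV[R]_n) :
  square_integrable P X -> (forall i, square_integrable P (Y i)) ->
  cross_moment X (fun w => \sum_(i <- s) Y i w) =
  \sum_(i <- s) cross_moment X (Y i).
Proof.
move=> sX sY; rewrite -tr_cross_moment cross_moment_suml// linear_sum/=.
by apply: eq_bigr => i _; rewrite tr_cross_moment.
Qed.

Lemma second_momentM m n (C : 'M[R]_(m, n)) (X : T -> 'cV[R]_n) :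
  square_integrable P X ->
  second_moment P (fun w => C *m X w) = C *m second_moment P X *m C^T.
Proof.
move=> sX; rewrite second_momentE cross_momentMl//; last exact: square_integrableM.
by rewrite cross_momentMr// mulmxA.
Qed.

(** The quadratic form at x is the mean of (x^T X)^2. *)
Lemma second_moment_psd n (X : T -> 'cV[R]_n) :
  square_integrable P X -> psdmx (second_moment P X).
Proof.
move=> sX; split; first by rewrite second_momentE tr_cross_moment.
move=> x; rewrite -[x in _ *m x]trmxK -second_momentM// mxE.
by apply: mean_ge0 => w; rewrite -expr2 sqr_ge0.
Qed.

Lemma second_moment_col m n (X : T -> 'cV[R]_m) (Y : T -> 'cV[R]_n) :
  second_moment P (fun w => col_mx (X w) (Y w)) =
  block_mx (second_moment P X) (cross_moment X Y)
    (cross_moment Y X) (second_moment P Y).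
Proof.
apply/matrixP => i j; rewrite mxE.
case: (split_ordP i) => i' ->; case: (split_ordP j) => j' ->.
- by rewrite block_mxEul mxE; under eq_fun do rewrite !col_mxEu.
- by rewrite block_mxEur mxE; under eq_fun do rewrite col_mxEu col_mxEd.
- by rewrite block_mxEdl mxE; under eq_fun do rewrite col_mxEu col_mxEd.
- by rewrite block_mxEdr mxE; under eq_fun do rewrite !col_mxEd.
Qed.

(** With H = blkdiag(Q, R) this turns an expected stage cost into the linear cost of (LQRcp). *)
Lemma mean_quad n (H : 'M[R]_n) (X : T -> 'cV[R]_n) :
  square_integrable P X ->
  (fun w => ((X w)^T *m H *m X w) 0 0) \in Lfun P 1 /\
  mean P (fun w => ((X w)^T *m H *m X w) 0 0) = \tr (second_moment P X *m H).
Proof.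
move=> sX.
have -> : (fun w => ((X w)^T *m H *m X w) 0 0) =
    fun w => \sum_b \sum_a H a b * (X w b 0 * X w a 0).
  apply/funext => w; rewrite mxE; apply: eq_bigr => b _.
  rewrite mxE mulr_suml; apply: eq_bigr => a _; rewrite mxE.
  by rewrite [X w a 0 * _]mulrC -mulrA [X w a 0 * _]mulrC.
have L a b : (fun w => H a b * (X w b 0 * X w a 0)) \in Lfun P 1.
  exact/Lfun1Z/Lfun2M.
split; first by apply: Lfun1_sum => b; exact: Lfun1_sum.
rewrite mean_sum; last by move=> b; exact: Lfun1_sum.
apply: eq_bigr => b _; rewrite mxE mean_sum//; apply: eq_bigr => a _.
by rewrite meanZ ?mxE 1?mulrC//; exact: Lfun2M.
Qed.

(** * Vectors multiplied by independent noise *)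

Section independent_product.
Context (m n : nat) (z : T -> 'cV[R]_m) (v : T -> 'cV[R]_n).
Hypotheses (sz : square_integrable P z) (sv : square_integrable P v).
Hypothesis zv : independent P (sigma_vec z) (sigma_vec v).

Let sigma_vecM k (X : T -> 'cV[R]_k) a b (B : set R) : measurable B ->
  sigma_vec X ((fun w => X w a 0 * X w b 0) @^-1` B).
Proof.
move=> mB; pose G := \big[setU/set0]_(i < k)
  preimage_set_system setT (fun w => X w i 0) measurable.
have mX i : measurable_fun setT (fun w : g_sigma_algebraType G => X w i 0).
  by move=> _ C mC; rewrite setTI; exact: sigma_vec_preimage.
have := measurable_funM (mX a) (mX b).
by move=> /(_ measurableT B mB); rewrite setTI.
Qed.

(** Each bracket is integrable as a product of two square-integrable functions, and the brackets are
    independent; so their product is integrable although no fourth moment is assumed. *)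
Let prodM a b i j :
  (fun w => (z w a 0 * z w b 0) * (v w i 0 * v w j 0)) \in Lfun P 1 /\
  mean P (fun w => (z w a 0 * z w b 0) * (v w i 0 * v w j 0)) =
  mean P (fun w => z w a 0 * z w b 0) * mean P (fun w => v w i 0 * v w j 0).
Proof.
have mf k (X : T -> 'cV[R]_k) c e : square_integrable P X ->
    measurable_fun setT (fun w => X w c 0 * X w e 0).
  by move=> sX; apply: measurable_funM; exact: square_integrable_rv.
pose f w := z w a 0 * z w b 0; pose g w := v w i 0 * v w j 0.
have ind (A B : set R) : measurable A -> measurable B ->
    P (f @^-1` A `&` g @^-1` B) = (P (f @^-1` A) * P (g @^-1` B))%E.
  by move=> mA mB; apply: zv; exact: sigma_vecM.
have Lz : (fun w => z w a 0 * z w b 0) \in Lfun P 1 by exact: Lfun2M.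
have Lv : (fun w => v w i 0 * v w j 0) \in Lfun P 1 by exact: Lfun2M.
split; first exact: (Lfun1M_indep (mf _ _ _ _ sz) (mf _ _ _ _ sv) ind).
exact: (meanM_indep (mf _ _ _ _ sz) (mf _ _ _ _ sv) ind).
Qed.

Lemma square_integrable_scale i :
  square_integrable P (fun w => v w i 0 *: z w).
Proof.
move=> a; under eq_fun do rewrite mxE; apply/Lfun2P; split.
  by apply: measurable_funM; exact: square_integrable_rv.
rewrite (_ : (fun w => _) =
    fun w => (z w a 0 * z w a 0) * (v w i 0 * v w i 0)).
  by have [] := prodM a a i i.
by apply/funext => w; ring.
Qed.

Lemma cross_moment_scale i j :
  cross_moment (fun w => v w i 0 *: z w) (fun w => v w j 0 *: z w) =
  second_moment P v i j *: second_moment P z.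
Proof.
apply/matrixP => a b; rewrite !mxE mulrC.
have [_ <-] := prodM a b i j.
by congr mean; apply/funext => w; rewrite !mxE; ring.
Qed.

(** With N_i = [A_i, B_i] the sum is the next state, so this is the second-moment recursion in the
    coordinates of v. *)
Lemma second_moment_bilinear p (N : 'I_n -> 'M[R]_(p, m)) :
  square_integrable P (fun w => \sum_i N i *m (v w i 0 *: z w)) /\
  second_moment P (fun w => \sum_i N i *m (v w i 0 *: z w)) =
  \sum_i \sum_j second_moment P v i j *: (N i *m second_moment P z *m (N j)^T).
Proof.
have sN i : square_integrable P (fun w => N i *m (v w i 0 *: z w)).
  exact/square_integrableM/square_integrable_scale.
split; first exact: square_integrable_sum.
rewrite second_momentE cross_moment_suml//; last exact: square_integrable_sum.
apply: eq_bigr => i _; rewrite cross_moment_sumr//.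
apply: eq_bigr => j _; rewrite cross_momentMl//; last exact: square_integrable_scale.
rewrite cross_momentMr//; [|exact: square_integrable_scale..].
by rewrite cross_moment_scale -scalemxAl -scalemxAr mulmxA.
Qed.

End independent_product.

End second_moments.

(** * The second-moment map in model coordinates *)

Section calE_model.
Context (R : realType) (nx nu nv nw : nat).
Variable M : 'I_nw -> 'M[R]_(nx, nx + nu).
Variables (C : 'M[R]_(nw, nv)) (N : 'I_nv -> 'M[R]_(nx, nx + nu)).
Hypothesis NE : forall i, N i = \sum_k C k i *: M k.

(** After expanding the N_i, the weight of M_k Z M_l^T is the sum over i, j of C_ki S_ij C_lj, an
    entry of C S C^T. *)
Lemma calE_model (S : 'M[R]_nv) (Z : 'M[R]_(nx + nu)) :
  \sum_i \sum_j S i j *: (N i *m Z *m (N j)^T) = calE M (C *m S *m C^T) Z.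
Proof.
pose F i j k l := (C k i * S i j * C l j) *: (M k *m Z *m (M l)^T).
transitivity (\sum_i \sum_j \sum_k \sum_l F i j k l).
  apply: eq_bigr => i _; apply: eq_bigr => j _.
  rewrite !NE linear_sum/= !mulmx_suml scaler_sumr; apply: eq_bigr => k _.
  rewrite mulmx_sumr scaler_sumr; apply: eq_bigr => l _.
  rewrite linearZ/= -scalemxAr -!scalemxAl !scalerA; congr (_ *: _); ring.
(* The sum over j is outermost of the two because the product C S C^T is parsed as (C S) C^T. *)
transitivity (\sum_k \sum_l \sum_j \sum_i F i j k l); last first.
  apply: eq_bigr => k _; apply: eq_bigr => l _.
  rewrite mxE scaler_suml; apply: eq_bigr => j _.
  by rewrite !mxE mulr_suml scaler_suml; apply: eq_bigr.
under eq_bigr do rewrite exchange_big/=.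
rewrite exchange_big/=; apply: eq_bigr => k _.
under eq_bigr do rewrite exchange_big/=.
by rewrite exchange_big/=; apply: eq_bigr => l _; rewrite exchange_big.
Qed.

End calE_model.

(** * Moments and cost along a feasible trajectory *)

Section dynamics.
Context (R : realType) (nx nu nv nw : nat).
Variables (A : 'I_nv -> 'M[R]_nx) (B : 'I_nv -> 'M[R]_(nx, nu)).
Variables (Q : 'M[R]_nx) (Ru : 'M[R]_nu).
Variable M : 'I_nw -> 'M[R]_(nx, nx + nu).
Context (d : measure_display) (T : measurableType d) (P : probability T R).
Variables (v : nat -> T -> 'cV[R]_nv) (x0 : T -> 'cV[R]_nx).
Variable u : nat -> T -> 'cV[R]_nu.

Local Notation state := (state A B v x0 u).
Local Notation state_input := (state_input A B v x0 u).

Lemma state_succE t :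
  state t.+1 =
  fun w => \sum_i row_mx (A i) (B i) *m (v t w i 0 *: state_input t w).
Proof.
apply/funext => w /=; rewrite /A_of /B_of !mulmx_suml -big_split/=.
apply: eq_bigr => i _; rewrite -!scalemxAl -scalerDr -scalemxAr.
by rewrite /Defs.state_input mul_row_col.
Qed.

Hypotheses (psdQ : pdmx Q) (psdRu : pdmx Ru).

Lemma stage_costE t w : stage_cost A B Q Ru v x0 u t w =
  ((state_input t w)^T *m block_mx Q 0 0 Ru *m state_input t w) 0 0.
Proof.
rewrite /stage_cost /Defs.state_input tr_col_mx mul_row_block.
by rewrite !mulmx0 addr0 add0r mul_row_col.
Qed.

Lemma pdmx_psd n (S : 'M[R]_n) : pdmx S -> psdmx S.
Proof.
move=> [ST S0]; split=> // x; have [->|/S0/ltW//] := eqVneq x 0.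
by rewrite mulmx0 mxE.
Qed.

Lemma stage_cost_ge0 t w : 0 <= stage_cost A B Q Ru v x0 u t w.
Proof.
by rewrite /stage_cost mxE addr_ge0//;
  [have [_ ->] := pdmx_psd psdQ|have [_ ->] := pdmx_psd psdRu].
Qed.

(** Stage costs are nonnegative, so sum and expectation commute even when the total is infinite. *)
Lemma slqr_costE : (forall t, square_integrable P (state_input t)) ->
  slqr_cost A B Q Ru P v x0 u =
  lqrcp_cost Q Ru (fun t => second_moment P (state_input t)).
Proof.
move=> sz.
have L t := mean_quad (block_mx Q 0 0 Ru) (sz t).
have cE t : stage_cost A B Q Ru v x0 u t =
    fun w => ((state_input t w)^T *m block_mx Q 0 0 Ru *m state_input t w) 0 0.
  by apply/funext => w; rewrite stage_costE.
rewrite /slqr_cost /lqrcp_cost integral_nneseries//.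
- apply: eq_eseriesr => t _; have [Lt <-] := L t.
  by rewrite -meanE// unlock cE.
- by move=> t; apply/measurable_EFinP; rewrite cE; apply: Lfun_measurable (L t).1.
- by move=> t w _; rewrite lee_fin stage_cost_ge0.
Qed.

Section feasible.
Variable S : 'M[R]_nv.
Hypothesis sv : forall t, square_integrable P (v t).
Hypothesis vS : forall t, second_moment P (v t) = S.
Hypothesis sx0 : square_integrable P x0.

Lemma independent_noise t : independent P (sigma_vec (state_input t))
  (sigma_from v t) -> independent P (sigma_vec (state_input t)) (sigma_vec (v t)).
Proof. by apply: independent_sub => //; exact: sigma_from_ge. Qed.

Lemma state_step t : model_equiv A B M ->
  square_integrable P (state_input t) ->
  independent P (sigma_vec (state_input t)) (sigma_from v t) ->
  square_integrable P (state t.+1) /\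
  second_moment P (state t.+1) =
    calE M (model_coef A B M *m S *m (model_coef A B M)^T)
      (second_moment P (state_input t)).
Proof.
move=> mE sz /independent_noise zv; rewrite state_succE.
have [s ->] := second_moment_bilinear sz (sv t) zv (fun i => row_mx (A i) (B i)).
split=> //; rewrite vS.
exact: calE_model (model_equivE mE) _ _.
Qed.

Hypothesis uF : slqr_feasible A B P v x0 u.

(** Feasibility constrains the inputs only; square integrability of the state propagates in time
    because v_t is independent of z_t. *)
Lemma feasible_square_integrable t : model_equiv A B M ->
  square_integrable P (state_input t).
Proof.
move=> mE; elim: t => [|t IHt].
  by apply: square_integrable_col => //; have [] := uF 0%N.
apply: square_integrable_col; last by have [] := uF t.+1.
by have [_ zv] := uF t; have [] := state_step mE IHt zv.
Qed.

Lemma lqrcp_feasible_moments : model_equiv A B M ->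
  lqrcp_feasible M (model_coef A B M *m S *m (model_coef A B M)^T)
    (second_moment P x0) (fun t => second_moment P (state_input t)).
Proof.
move=> mE; have sz t := feasible_square_integrable t mE.
split=> [t||t]; first exact: second_moment_psd.
  by rewrite second_moment_col block_mxKul.
rewrite second_moment_col block_mxKul.
by have [_ zv] := uF t; have [] := state_step mE (sz t) zv.
Qed.

End feasible.

End dynamics.

(** * Randomization *)

Section extension_transfer.
Context (R : realType) (d : measure_display) (T : measurableType d).
Variables (P : probability T R) (e : extension P).

Lemma ext_measure (E : set T) : measurable E ->
  ext_prob e (ext_proj e @^-1` E) = P E.
Proof. exact: ext_law. Qed.

Lemma ext_mean (f : T -> R) : f \in Lfun P 1 ->
  f \o ext_proj e \in Lfun (ext_prob e) 1 /\
  mean (ext_prob e) (f \o ext_proj e) = mean P f.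
Proof.
move=> f1; have mf := Lfun_measurable f1.
have mfe : measurable_fun setT (f \o ext_proj e) by exact: measurableT_comp.
have law (A : set R) : measurable A ->
    P (f @^-1` A) = ext_prob e ((f \o ext_proj e) @^-1` A).
  move=> mA; rewrite -[in LHS]ext_measure//.
  by rewrite -[X in measurable X]setTI; exact: mf.
by split; [exact: (Lfun1_law mf mfe law)|rewrite (mean_law mf mfe law)].
Qed.

Lemma ext_square_integrable n (X : T -> 'cV[R]_n) :
  square_integrable P X -> square_integrable (ext_prob e) (X \o ext_proj e).
Proof.
move=> sX i; have [mX X2] := (Lfun2P P _).1 (sX i).
apply/Lfun2P; split; last by have [] := ext_mean X2.
exact: (measurableT_comp mX).
Qed.

Lemma ext_second_moment n (X : T -> 'cV[R]_n) : square_integrable P X ->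
  second_moment (ext_prob e) (X \o ext_proj e) = second_moment P X.
Proof.
move=> sX; apply/matrixP => i j; rewrite !mxE.
by have [_] := ext_mean (Lfun2M (sX i) (sX j)).
Qed.

End extension_transfer.

(** The event that v_i v_j lies in A is the preimage under v of a Borel set of vectors, so its
    probability is the same at all times. *)
Lemma identically_distributed_second_moment (R : realType) (d : measure_display)
    (T : measurableType d) (P : probability T R) n (v : nat -> T -> 'cV[R]_n) :
  identically_distributed P v -> (forall t, square_integrable P (v t)) ->
  forall t, second_moment P (v t) = second_moment P (v 0%N).
Proof.
move=> idv sv t; apply/matrixP => i j; rewrite !mxE.
have L s : (fun w => v s w i 0 * v s w j 0) \in Lfun P 1 by exact: Lfun2M (sv s i) (sv s j).
apply: (mean_law (Lfun_measurable (L t)) (Lfun_measurable (L 0%N)) _ (L t)).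
move=> A mA; apply: (idv t 0%N [set x : 'cV[R]_n | A (x i 0 * x j 0)]).
pose G := \big[setU/set0]_(i < n)
  preimage_set_system setT (fun x : 'cV[R]_n => x i 0) measurable.
have mX k : measurable_fun setT (fun x : g_sigma_algebraType G => x k 0).
  move=> _ C mC; rewrite setTI; apply: sub_sigma_algebra.
  by rewrite /G (bigD1 k)//=; left; exists C => //; rewrite setTI.
have := measurable_funM (mX i) (mX j).
by move=> /(_ measurableT A mA); rewrite setTI.
Qed.

(** * A noise sequence with disjoint supports *)

Section noise.
Context (R : realType).

(** The Poisson law of parameter 1 is chosen because it charges every natural number. *)
Let mu : probability nat R := poisson_prob (1 : R) 0.

Let mass k : R := fine (mu [set k]).

Let mass_gt0 k : 0 < mass k.
Proof.
rewrite /mass /mu/= /poisson_prob ltr01 esum_set1; last first.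
  by rewrite lee_fin poisson_pmf_ge0.
by rewrite /poisson_pmf ltr01/= !mulr_gt0 ?expR_gt0 ?exprn_gt0 ?invr_gt0 ?ltr0n ?fact_gt0.
Qed.

Let Lfun_indic k : (\1_[set k] : nat -> R) \in Lfun mu 1.
Proof. by apply/Lfun1_integrable; apply: integrable_indic. Qed.

Let mean_indic k : mean mu \1_[set k] = mass k.
Proof. by rewrite /mean expectation_indic. Qed.

Let two_points (a b : R) m n (k : nat) : R :=
  a * \1_[set m] k + b * \1_[set n] k.

Let Lfun_two_points a b m n : two_points a b m n \in Lfun mu 1.
Proof. by apply: Lfun1D; exact: Lfun1Z. Qed.

Let mean_two_points a b m n :
  mean mu (two_points a b m n) = a * mass m + b * mass n.
Proof. by rewrite meanD ?meanZ ?mean_indic//; exact: Lfun1Z. Qed.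

Let indicE1 (m k : nat) : \1_[set m] k = (k == m)%:R :> R.
Proof. by rewrite indicE in_set1. Qed.

(** Let p and q be the masses of the two atoms. The values norm / p and - norm / q have mean norm -
    norm = 0 and second moment norm^2 (1/p + 1/q), which this choice makes 1. *)
Let norm n : R := Num.sqrt ((mass n.*2)^-1 + (mass n.*2.+1)^-1)^-1.

Let eps n := two_points (norm n / mass n.*2) (- (norm n / mass n.*2.+1))
  n.*2 n.*2.+1.

Let eps_sqr n k : eps n k ^+ 2 =
  two_points ((norm n / mass n.*2) ^+ 2) ((norm n / mass n.*2.+1) ^+ 2)
    n.*2 n.*2.+1 k.
Proof.
rewrite /eps /two_points !indicE1.
have [->|_] := eqVneq k n.*2.
  by rewrite ltn_eqF//= mulr1n mulr0n; ring.
by case: (k == _) => /=; rewrite ?mulr1n mulr0n; ring.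
Qed.

(* Noise supported on pairwise disjoint pairs of atoms {2n, 2n+1}: at most one
   coordinate is nonzero at each point, so that all cross products vanish. *)
Lemma disjoint_noise : exists (mu : probability nat R) (eps : nat -> nat -> R),
  [/\ forall n, eps n \in Lfun mu 2%:E,
      forall n, mean mu (eps n) = 0,
      forall n, mean mu (fun k => eps n k ^+ 2) = 1
    & forall m n k, m != n -> eps m k * eps n k = 0].
Proof.
exists mu, eps; split.
- move=> n; apply/Lfun2P; split => //.
  by under eq_fun do rewrite eps_sqr; exact: Lfun_two_points.
- move=> n; rewrite mean_two_points; have := mass_gt0 n.*2.
  by have := mass_gt0 n.*2.+1 => /gt_eqF ? /gt_eqF ?; field; apply/andP; split; apply/negbT.
- move=> n; under eq_fun do rewrite eps_sqr.
  have p := mass_gt0 n.*2; have q := mass_gt0 n.*2.+1.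
  rewrite mean_two_points !exprMn /norm sqr_sqrtr; last first.
    by rewrite invr_ge0 addr_ge0// invr_ge0 ltW.
  by field; rewrite !gt_eqF// addr_gt0.
- move=> m n k mn; rewrite /eps /two_points !indicE1.
  have dbl a b : (a.*2 == b.*2.+1) = false.
    by apply/negP => /eqP/(congr1 odd); rewrite /= !odd_double.
  have [->|k1] := eqVneq k m.*2.
    by rewrite -!muln2 eqn_mul2r/= !muln2 (negbTE mn) !dbl/= mulr0n; ring.
  have [->|k2] := eqVneq k m.*2.+1; last by rewrite /= mulr0n; ring.
  by rewrite eqSS -!muln2 eqn_mul2r/= !muln2 (negbTE mn) [_ == n.*2]eq_sym !dbl/= mulr0n; ring.
Qed.

End noise.

(** * Product of the given space with the noise space *)

Section product_extension.
Context (R : realType) (d : measure_display) (T : measurableType d).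
Variables (P : probability T R) (mu : probability nat R).

HB.instance Definition _ := @isMeasurableFun.Build _ _ (nat * T)%type T snd
  (@measurable_snd _ _ nat T).

Let PP : probability (nat * T)%type R := (mu \x P)%E.

Let PP_snd (E : set T) : measurable E -> PP (snd @^-1` E) = P E.
Proof.
move=> mE; transitivity (mu setT * P E)%E.
  by rewrite -setTX; exact: product_measure1E.
by rewrite probability_setT mul1e.
Qed.

Let PP_fst (E : set nat) : PP (fst @^-1` E) = mu E.
Proof.
transitivity (mu E * P setT)%E.
  by rewrite -setXT; exact: product_measure1E.
by rewrite probability_setT mule1.
Qed.

Definition product_extension : extension P :=
  @Extension _ _ _ P _ (nat * T)%type PP snd PP_snd.

Lemma mean_fst (f : nat -> R) : f \in Lfun mu 1 ->
  f \o fst \in Lfun PP 1 /\ mean PP (f \o fst) = mean mu f.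
Proof.
move=> f1; have mf : measurable_fun setT f by [].
have mff : measurable_fun setT (f \o fst : nat * T -> R).
  exact: measurableT_comp.
have law (A : set R) : measurable A ->
    mu (f @^-1` A) = PP ((f \o fst) @^-1` A).
  by move=> mA; rewrite -PP_fst.
by split; [exact: (Lfun1_law mf mff law)|rewrite (mean_law mf mff law)].
Qed.

Lemma mean_fst_snd (f : nat -> R) (g : T -> R) :
  f \in Lfun mu 1 -> g \in Lfun P 1 ->
  mean PP (fun p => f p.1 * g p.2) = mean mu f * mean P g.
Proof.
move=> f1 g1; have mf : measurable_fun setT f by [].
have [ff1 <-] := mean_fst f1.
have [gg1 <-] := ext_mean product_extension g1.
have mg := Lfun_measurable g1.
apply: (meanM_indep (Lfun_measurable ff1) (Lfun_measurable gg1) _ ff1 gg1).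
move=> A B mA mB.
have mgB : measurable (g @^-1` B) by rewrite -[X in measurable X]setTI; exact: mg.
rewrite [X in (X * _)%E](PP_fst (f @^-1` A)).
rewrite [X in (_ * X)%E](PP_snd mgB).
rewrite (_ : _ `&` _ = (f @^-1` A) `*` (g @^-1` B))//.
exact: product_measure1E.
Qed.

(** Fix the noise outcome k: the section at k of an event of z lies in F, hence is independent of
    the future. Integrating the sectionwise identity over k concludes. *)
Lemma independent_product m n (z : nat * T -> 'cV[R]_m) (v : nat -> T -> 'cV[R]_n)
    t (F : set (set T)) :
  random_vector z -> (forall s, random_vector (v s)) ->
  sigma_algebra setT F ->
  (forall k, sigma_vec (fun w => z (k, w)) `<=` F) ->
  independent P F (sigma_from v t) ->
  independent PP (sigma_vec z) (sigma_from (fun s => v s \o snd) t).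
Proof.
move=> mz mv FA zF Fv E1 _ zE1 /sigma_from_comp[E2 vE2 ->].
have FE1 k : F (xsection E1 k).
  suff sub : sigma_vec z `<=` [set E | F (xsection E k)] by exact: sub.
  apply: sigma_vec_sub => [|i B mB].
    (* The sets whose section at k belongs to F form the image of F under w |-> (k, w), hence a
       sigma-algebra. *)
    rewrite (_ : [set E | _] = image_set_system setT (pair k) F).
      exact: sigma_algebra_image.
    apply/seteqP; split=> E; rewrite /image_set_system/= setTI.
      by rewrite xsectionE.
    by rewrite xsectionE.
  rewrite /= xsectionE; apply: (zF k).
  exact: (@sigma_vec_preimage _ _ _ _ (fun w => z (k, w)) i B).
have mE1 : measurable E1 by exact: sigma_vec_measurable zE1.
have mE2 : measurable E2 by exact: sigma_from_sub vE2.
rewrite [X in (_ * X)%E](PP_snd mE2).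
rewrite [LHS](_ : _ = \int[mu]_k (P (xsection E1 k) * P E2))%E; last first.
  apply: eq_integral => k _ /=; rewrite xsectionI xsection_preimage_snd.
  exact: Fv.
by rewrite ge0_integralZr//; exact: measurable_fun_xsection.
Qed.

End product_extension.

(** * Closed loop *)

Section closed_loop.
Context (R : realType) (nx nu nv : nat).
Variables (A : 'I_nv -> 'M[R]_nx) (B : 'I_nv -> 'M[R]_(nx, nu)).
Variable K : nat -> 'M[R]_(nu, nx).

Section deterministic_offset.
Context (d : measure_display) (T : measurableType d).
Variables (v : nat -> T -> 'cV[R]_nv) (x0 : T -> 'cV[R]_nx).

(** The trajectory for one frozen outcome of the input noise: with constant offsets [dl] it is a
    function on T alone, determined by x0 and the past of v. *)
Fixpoint closed_loop (dl : nat -> 'cV[R]_nu) t (w : T) : 'cV[R]_nx :=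
  if t is s.+1 then
    A_of A (v s w) *m closed_loop dl s w +
    B_of B (v s w) *m (K s *m closed_loop dl s w + dl s)
  else x0 w.

Definition feedback (dl : nat -> 'cV[R]_nu) t w :=
  K t *m closed_loop dl t w + dl t.

Lemma state_feedback dl t : state A B v x0 (feedback dl) t = closed_loop dl t.
Proof. by elim: t => //= t ->. Qed.

(** Allows the noise to be replaced by zero wherever all offsets before time t vanish. *)
Lemma eq_closed_loop dl dl' t : (forall s, (s < t)%N -> dl s = dl' s) ->
  closed_loop dl t = closed_loop dl' t.
Proof.
elim: t => // t IHt dlE; apply/funext => w /=.
by rewrite IHt ?dlE// => s st; rewrite dlE// ltnW.
Qed.

(** The sigma-algebra is kept at the later time s, so it does not change during the induction on
    t. *)
Lemma closed_loop_past dl t s (i : 'I_nx) : (t <= s)%N ->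
  measurable_fun setT
    (fun w : g_sigma_algebraType (past_gen v x0 s) => closed_loop dl t w i 0).
Proof.
elim: t i => [|t IHt] i ts.
  move=> _ C mC; rewrite setTI; apply: sub_sigma_algebra; left.
  exact: sigma_vec_preimage.
have mv l : measurable_fun setT
    (fun w : g_sigma_algebraType (past_gen v x0 s) => v t w l 0).
  move=> _ C mC; rewrite setTI; apply: sub_sigma_algebra; right.
  by exists t => //; exact: sigma_vec_preimage.
have mx j := IHt j (ltnW ts).
rewrite (_ : (fun w => _) = fun w =>
   \sum_j (\sum_l v t w l 0 * A l i j) * closed_loop dl t w j 0 +
   \sum_j (\sum_l v t w l 0 * B l i j) *
     (\sum_k K t j k * closed_loop dl t w k 0 + dl t j 0)).
  apply: measurable_funD; apply: measurable_sum => j; apply: measurable_funM.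
  - by apply: measurable_sum => l; exact: measurable_funM.
  - exact: mx.
  - by apply: measurable_sum => l; exact: measurable_funM.
  - apply: measurable_funD => //; apply: measurable_sum => k.
    by apply: measurable_funM => //; exact: mx.
apply/funext => w; rewrite /= mxE; congr (_ + _).
  rewrite mxE; apply: eq_bigr => j _; rewrite /A_of summxE.
  by congr (_ * _); apply: eq_bigr => l _; rewrite mxE.
rewrite mxE; apply: eq_bigr => j _; rewrite /B_of summxE.
by rewrite !mxE; congr (_ * _); apply: eq_bigr => l _; rewrite mxE.
Qed.

Lemma feedback_past dl t :
  sigma_vec (state_input A B v x0 (feedback dl) t) `<=` <<s past_gen v x0 t>>.
Proof.
apply: sigma_vec_sub; first exact: smallest_sigma_algebra.
have mx j := closed_loop_past dl j (leqnn t).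
move=> i C mC.
suff m : measurable_fun setT (fun w : g_sigma_algebraType (past_gen v x0 t) =>
    state_input A B v x0 (feedback dl) t w i 0).
  by have := m measurableT C mC; rewrite setTI.
rewrite /state_input state_feedback; case: (split_ordP i) => j ->.
  by under eq_fun do rewrite col_mxEu; exact: mx.
under eq_fun do rewrite col_mxEd /feedback mxE mxE.
apply: measurable_funD => //; apply: measurable_sum => k.
by apply: measurable_funM => //; exact: mx.
Qed.

End deterministic_offset.

(** * Feasibility and moments of noisy feedback *)

Section feasibility.
Context (nw : nat) (M : 'I_nw -> 'M[R]_(nx, nx + nu)).
Context (d : measure_display) (T : measurableType d) (P : probability T R).
Variables (v : nat -> T -> 'cV[R]_nv) (x0 : T -> 'cV[R]_nx).
Variables (u delta : nat -> T -> 'cV[R]_nu) (S : 'M[R]_nv).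
Hypothesis mE : model_equiv A B M.
Hypothesis sv : forall t, square_integrable P (v t).
Hypothesis vS : forall t, second_moment P (v t) = S.
Hypothesis sx0 : square_integrable P x0.
Hypothesis uE : forall t w, u t w = K t *m state A B v x0 u t w + delta t w.
Hypothesis sdelta : forall t, square_integrable P (delta t).
Hypothesis zv : forall t, random_vector (state_input A B v x0 u t) ->
  independent P (sigma_vec (state_input A B v x0 u t)) (sigma_from v t).

(** Hypothesis [zv] grants independence only once z_t is measurable. The induction supplies this:
    square integrability at time t unlocks [zv], which yields the next state. *)
Lemma feedback_square_integrable t :
  square_integrable P (state A B v x0 u t) /\ square_integrable P (u t).
Proof.
have su s : square_integrable P (state A B v x0 u s) ->
    square_integrable P (u s).
  move=> sx; rewrite (_ : u s = fun w => K s *m state A B v x0 u s w + delta s w).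
    by apply: square_integrableD => //; exact: square_integrableM.
  by apply/funext => w; exact: uE.
elim: t => [|t [sx suT]]; first by split => //; exact: su.
have sz := square_integrable_col sx suT.
have [sx' _] := state_step sv vS mE sz (zv (square_integrable_rv sz)).
by split => //; exact: su.
Qed.

Lemma feedback_feasible : slqr_feasible A B P v x0 u.
Proof.
move=> t; have [sx su] := feedback_square_integrable t; split => //.
exact: zv (square_integrable_rv (square_integrable_col sx su)).
Qed.

(** Given E[x x^T] = X and offsets uncorrelated with x, E[x u^T] = X K^T = V, and E[u u^T] is K X
    K^T plus the Schur complement, which is U. The constraint of (LQRcp) then carries the match to
    the next state. *)
Lemma feedback_moments (Z : nat -> 'M[R]_(nx + nu)) :
  lqrcp_feasible M (model_coef A B M *m S *m (model_coef A B M)^T)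
    (second_moment P x0) Z ->
  (forall t, K t *m ulsubmx (Z t) = dlsubmx (Z t)) ->
  (forall t, cross_moment P (state A B v x0 u t) (delta t) = 0) ->
  (forall t, second_moment P (delta t) =
     drsubmx (Z t) - K t *m ulsubmx (Z t) *m (K t)^T) ->
  forall t, second_moment P (state_input A B v x0 u t) = Z t.
Proof.
move=> [psdZ Z0 Zt] KE xdelta deltaE t.
have step s : second_moment P (state A B v x0 u s) = ulsubmx (Z s) ->
    second_moment P (state_input A B v x0 u s) = Z s.
  move=> xE; have [sx su] := feedback_square_integrable s.
  have sKx := square_integrableM (K s) sx.
  have uE' : u s = fun w => K s *m state A B v x0 u s w + delta s w.
    by apply/funext => w; exact: uE.
  have xu : cross_moment P (state A B v x0 u s) (u s) = ursubmx (Z s).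
    rewrite uE' cross_momentDr// cross_momentMr// xdelta addr0.
    rewrite -second_momentE xE.
    have [ZT _] := psdZ s.
    by rewrite -[ulsubmx _]trmxK trmx_ulsub ZT -trmx_mul KE trmx_dlsub ZT.
  rewrite second_moment_col -[cross_moment P (u s) _]tr_cross_moment xu xE.
  rewrite (_ : second_moment P (u s) = drsubmx (Z s)).
    have [ZT _] := psdZ s.
    by rewrite trmx_ursub ZT submxK.
  rewrite second_momentE uE'.
  rewrite cross_momentDl//; last exact: square_integrableD.
  rewrite !cross_momentDr// !cross_momentMl// !cross_momentMr// xdelta.
  rewrite -[cross_moment P (delta s) (state _ _ _ _ _ _)]tr_cross_moment xdelta.
  rewrite trmx0 mul0mx mulmx0 addr0 add0r.
  by rewrite -!second_momentE xE deltaE mulmxA addrC subrK.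
apply: (step); elim: t => [|t IHt]; first by rewrite Z0.
have [sx su] := feedback_square_integrable t.
have sz := square_integrable_col sx su.
have [_ ->] := state_step sv vS mE sz (zv (square_integrable_rv sz)).
by rewrite (step _ IHt) Zt.
Qed.

End feasibility.

End closed_loop.

(** * Realizing a feasible moment sequence *)

Section realization.
Context (R : realType) (nx nu nv nw : nat).
Variables (A : 'I_nv -> 'M[R]_nx) (B : 'I_nv -> 'M[R]_(nx, nu)).
Variable M : 'I_nw -> 'M[R]_(nx, nx + nu).
Context (d : measure_display) (T : measurableType d) (P : probability T R).
Variables (v : nat -> T -> 'cV[R]_nv) (x0 : T -> 'cV[R]_nx).
Variable S : 'M[R]_nv.
Hypothesis mE : model_equiv A B M.
Hypothesis sv : forall t, square_integrable P (v t).
Hypothesis vS : forall t, second_moment P (v t) = S.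
Hypothesis sx0 : square_integrable P x0.
Hypothesis v_indep : mutually_independent P v.
Hypothesis x0v : independent P (sigma_vec x0) (sigma_from v 0).

Lemma lqrcp_feasible_realization (Z : nat -> 'M[R]_(nx + nu)) :
  lqrcp_feasible M (model_coef A B M *m S *m (model_coef A B M)^T)
    (second_moment P x0) Z ->
  exists (e : extension P) (u : nat -> e -> 'cV[R]_nu)
    (K : nat -> 'M[R]_(nu, nx)) (delta : nat -> e -> 'cV[R]_nu),
    let ve t := v t \o ext_proj e in
    let x0e := x0 \o ext_proj e in
    [/\ slqr_feasible A B (ext_prob e) ve x0e u,
        forall t, random_vector (delta t),
        forall t w, u t w = K t *m state A B ve x0e u t w + delta t w
      & forall t, Z t =
          second_moment (ext_prob e) (state_input A B ve x0e u t)].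
Proof.
move=> ZF; have [psdZ _ _] := ZF.
have /choice[KL KLE] : forall t, exists KL : 'M[R]_(nu, nx) * 'M[R]_nu,
    KL.1 *m ulsubmx (Z t) = dlsubmx (Z t) /\
    drsubmx (Z t) - KL.1 *m ulsubmx (Z t) *m KL.1^T = KL.2 *m KL.2^T.
  move=> t; have [K KE /psdmx_gram[L LE]] := psdmx_schur (psdZ t).
  by exists (K, L).
pose K t := (KL t).1; pose L t := (KL t).2.
have [mu [eps [eps2 eps0 eps1 epsM]]] := disjoint_noise R.
pose e := product_extension P mu.
(* Time t receives the block of noise indices from t nu to t nu + nu - 1, so different times and
   components use different [eps]. *)
pose xi t (k : nat) : 'cV[R]_nu := \col_i eps (t * nu + i)%N k.
pose dl (k : nat) t := L t *m xi t k.
pose delta t (p : e) : 'cV[R]_nu := dl p.1 t.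
pose u t (p : e) : 'cV[R]_nu := feedback A B K v x0 (dl p.1) t p.2.
pose ve t := v t \o ext_proj e.
pose x0e := x0 \o ext_proj e.
have stE t p : state A B ve x0e u t p = closed_loop A B K v x0 (dl p.1) t p.2.
  by elim: t => //= t ->.
have uE t p : u t p = K t *m state A B ve x0e u t p + delta t p.
  by rewrite stE.
have sve t : square_integrable (ext_prob e) (ve t) by exact: ext_square_integrable.
have veS t : second_moment (ext_prob e) (ve t) = S.
  by rewrite ext_second_moment.
have sx0e : square_integrable (ext_prob e) x0e by exact: ext_square_integrable.
have sxi t : square_integrable (ext_prob e) (xi t \o fst).
  move=> i; apply/Lfun2P; have [_ e2] := (Lfun2P mu _).1 (eps2 (t * nu + i)%N).
  have [e2' _] := mean_fst P e2.
  split; last by under eq_fun do rewrite mxE.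
  under eq_fun do rewrite mxE.
  by apply: (measurableT_comp _ (@measurable_fst _ _ nat T)).
have sdelta t : square_integrable (ext_prob e) (delta t).
  exact: (square_integrableM (L t) (sxi t)).
have mv t := square_integrable_rv (sv t).
have mx0 := square_integrable_rv sx0.
have FA t : sigma_algebra setT <<s past_gen v x0 t>>.
  exact: smallest_sigma_algebra.
have past t := independent_past_future mv mx0 v_indep x0v t.
have secE k t : (fun w => state_input A B ve x0e u t (k, w)) =
    state_input A B v x0 (feedback A B K v x0 (dl k)) t.
  by apply/funext => w; rewrite /state_input stE state_feedback.
have mst t : random_vector (state_input A B ve x0e u t) ->
    independent (ext_prob e) (sigma_vec (state_input A B ve x0e u t))
      (sigma_from ve t).
  move=> mz.
  have sub k : sigma_vec (fun w => state_input A B ve x0e u t (k, w)) `<=`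
      <<s past_gen v x0 t>>.
    by rewrite secE; exact: feedback_past.
  exact: (@independent_product _ _ _ P mu _ _ _ v t _ mz mv (FA t) sub (past t)).
have Lfun1_of2 d' (T' : measurableType d') (P' : probability T' R) (f : T' -> R) :
    f \in Lfun P' 2%:E -> f \in Lfun P' 1.
  by apply: Lfun_subset12; rewrite fin_num_measure.
(* The noise-free trajectory is itself a feedback trajectory on the original space, with zero
   offset. *)
have scl t : square_integrable P (closed_loop A B K v x0 (fun=> 0) t).
  rewrite -state_feedback.
  have fE s w : feedback A B K v x0 (fun=> 0) s w =
      K s *m state A B v x0 (feedback A B K v x0 (fun=> 0)) s w + 0.
    by rewrite state_feedback.
  have s0 (s : nat) : square_integrable P (fun=> 0 : 'cV[R]_nu).
    by move=> i; under eq_fun do rewrite mxE; exact: Lfun_cst.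
  apply: (feedback_square_integrable mE sv vS sx0 fE s0 _ t).1 => s _.
  by apply: independent_sub (past s) => //; exact: feedback_past.
have xi_le s t (i j : 'I_nu) : (s < t)%N -> (s * nu + i)%N != (t * nu + j)%N :> nat.
  move=> st; rewrite neq_ltn; apply/orP; left.
  have : (s * nu + i < s.+1 * nu)%N by rewrite mulSn [X in (_ < X)%N]addnC ltn_add2l.
  move=> /leq_trans; apply; apply: leq_trans (leq_addr _ _).
  by rewrite leq_mul2r st orbT.
(* An outcome k that activates a component of time t silences every component of the earlier
   times. *)
have dl0 t k (j : 'I_nu) s : eps (t * nu + j)%N k != 0 -> (s < t)%N -> dl k s = 0.
  move=> e0 st; rewrite /dl (_ : xi s k = 0) ?mulmx0//.
  apply/colP => i; rewrite !mxE.
  have /eqP := epsM _ _ k (xi_le s t i j st).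
  by rewrite mulf_eq0 (negbTE e0) orbF => /eqP.
have sx t : square_integrable (ext_prob e) (state A B ve x0e u t).
  by have [] := feedback_square_integrable mE sve veS sx0e uE sdelta mst t.
have xdelta t : cross_moment (ext_prob e) (state A B ve x0e u t) (delta t) = 0.
  rewrite [delta t](_ : _ = fun p => L t *m (xi t \o fst) p)//.
  rewrite cross_momentMr//.
  rewrite (_ : cross_moment _ _ _ = 0) ?mul0mx//.
  apply/matrixP => i j; rewrite !mxE.
  have Leps := Lfun1_of2 _ _ _ _ (eps2 (t * nu + j)%N).
  (* Pointwise, either [eps] vanishes or the state equals its noise-free value. The product now
     separates into a function of the noise and one of T, and the noise factor has mean zero. *)
  transitivity (mean (ext_prob e) (fun p => eps (t * nu + j)%N p.1 *
      closed_loop A B K v x0 (fun=> 0) t p.2 i 0)).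
    congr mean; apply/funext => p; rewrite mxE mulrC.
    have [->|e0] := eqVneq (eps (t * nu + j)%N p.1) 0; first by rewrite !mul0r.
    rewrite stE (@eq_closed_loop _ _ _ _ _ _ _ _ _ _ _ _ (fun=> 0))//.
    by move=> s; exact: dl0 e0.
  have Lcl := Lfun1_of2 _ _ _ _ (scl t i).
  by apply: etrans (mean_fst_snd Leps Lcl) _; rewrite eps0 mul0r.
have deltaE t : second_moment (ext_prob e) (delta t) =
    drsubmx (Z t) - K t *m ulsubmx (Z t) *m (K t)^T.
  have [_ ->] := KLE t.
  rewrite [delta t](_ : _ = fun p => L t *m (xi t \o fst) p)//.
  rewrite second_momentM// (_ : second_moment _ _ = 1%:M) ?mulmx1//.
  apply/matrixP => i j; rewrite !mxE.
  have Le : (fun k => eps (t * nu + i)%N k * eps (t * nu + j)%N k) \in Lfun mu 1.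
    exact: Lfun2M.
  (* The covariance of [xi t] is the identity: unit second moments on the diagonal, disjoint
     supports off it. *)
  transitivity (mean mu (fun k => eps (t * nu + i)%N k * eps (t * nu + j)%N k)).
    have [_ <-] := mean_fst P Le.
    by congr mean; apply/funext => p; rewrite /= !mxE.
  have [->|ij] := eqVneq i j; first by rewrite -[RHS](eps1 (t * nu + j)%N).
  under eq_fun do rewrite epsM ?eqn_add2l//.
  by rewrite mean0.
exists e, u, K, delta; split.
- exact: (feedback_feasible mE sve veS sx0e uE sdelta mst).
- by move=> t; exact: square_integrable_rv.
- exact: uE.
- move=> t; apply/esym.
  apply: (feedback_moments mE sve veS sx0e uE sdelta mst _ _ xdelta deltaE).
    by rewrite ext_second_moment.
  by move=> s; have [] := KLE s.
Qed.

End realization.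

Theorem mainTheorem1 (R : realType) (nx nu nv nw : nat)
    (A : 'I_nv -> 'M[R]_nx) (B : 'I_nv -> 'M[R]_(nx, nu))
    (Q : 'M[R]_nx) (Ru : 'M[R]_nu)
    (M : 'I_nw -> 'M[R]_(nx, nx + nu))
    (d : measure_display) (T : measurableType d) (P : probability T R)
    (v : nat -> T -> 'cV[R]_nv) (x0 : T -> 'cV[R]_nx) :
  pdmx Q -> pdmx Ru ->
  iid P v -> (forall t, square_integrable P (v t)) ->
  square_integrable P x0 -> independent P (sigma_vec x0) (sigma_from v 0) ->
  model_equiv A B M ->
  let W := second_moment P (model_noise A B M \o v 0%N) in
  let X0 := second_moment P x0 in
  slqr_val A B Q Ru P v x0 = lqrcp_val M W X0 Q Ru /\
  forall Z : nat -> 'M[R]_(nx + nu),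
    lqrcp_feasible M W X0 Z <->
    exists (e : extension P) (u : nat -> e -> 'cV[R]_nu)
      (K : nat -> 'M[R]_(nu, nx)) (delta : nat -> e -> 'cV[R]_nu),
      let ve t := v t \o ext_proj e in
      let x0e := x0 \o ext_proj e in
      [/\ slqr_feasible A B (ext_prob e) ve x0e u,
          forall t, random_vector (delta t),
          forall t w, u t w = K t *m state A B ve x0e u t w + delta t w
        & forall t, Z t =
            second_moment (ext_prob e) (state_input A B ve x0e u t)].
Proof.
move=> pQ pRu [_ v_indep v_id] sv sx0 x0v mE W X0.
set S := second_moment P (v 0%N).
(* [model_noise] is multiplication by [model_coef], so W is the congruence of S by that matrix. *)
have WE : W = model_coef A B M *m S *m (model_coef A B M)^T.
  exact: second_momentM (sv 0%N).
have vS : forall t, second_moment P (v t) = S.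
  exact: identically_distributed_second_moment.
have realize := lqrcp_feasible_realization mE sv vS sx0 v_indep x0v.
have sve (e : extension P) t : square_integrable (ext_prob e) (v t \o ext_proj e).
  exact: ext_square_integrable.
have veS (e : extension P) t :
    second_moment (ext_prob e) (v t \o ext_proj e) = S.
  by rewrite ext_second_moment.
have sx0e (e : extension P) : square_integrable (ext_prob e) (x0 \o ext_proj e).
  exact: ext_square_integrable.
have moments (e : extension P) u :
    slqr_feasible A B (ext_prob e) (fun t => v t \o ext_proj e)
      (x0 \o ext_proj e) u ->
    lqrcp_feasible M W X0 (fun t => second_moment (ext_prob e)
      (state_input A B (fun t => v t \o ext_proj e) (x0 \o ext_proj e) u t)).
  move=> uF; rewrite WE /X0 -(ext_second_moment e sx0).
  exact: (lqrcp_feasible_moments (sve e) (veS e) (sx0e e) uF mE).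
have cost (e : extension P) u :
    slqr_feasible A B (ext_prob e) (fun t => v t \o ext_proj e)
      (x0 \o ext_proj e) u ->
    slqr_cost A B Q Ru (ext_prob e) (fun t => v t \o ext_proj e)
      (x0 \o ext_proj e) u =
    lqrcp_cost Q Ru (fun t => second_moment (ext_prob e)
      (state_input A B (fun t => v t \o ext_proj e) (x0 \o ext_proj e) u t)).
  move=> uF; apply: slqr_costE => // t.
  exact: (feasible_square_integrable (sve e) (veS e) (sx0e e) uF _ mE).
split; last first.
  move=> Z; split=> [ZF|[e [u [K [delta [uF _ _ ZE]]]]]].
    by apply: realize; rewrite -WE.
  by rewrite (funext ZE); exact: moments.
(* Both problems attain exactly the same set of costs, infinite values included, so no limiting
   argument is required for the infima. *)
congr ereal_inf; apply/seteqP; split=> [c [e [u [uF ->]]]|c [Z ZF <-]].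
  by rewrite cost//; eexists; [exact: (moments _ _ uF)|].
have [|e [u [K [delta [uF _ _ ZE]]]]] := realize Z; first by rewrite -WE.
by exists e, u; split=> //; rewrite cost// (funext ZE).
Qed.
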